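(* Let $k,n\in\mathbb N$ with $1\le k\le n$, let $\lambda\vdash n$ and $x\in\lambda$. Then $$d_\lambda(k,x)=\frac{n!}{n-k+1}\left(1-\sum_{l=1}^{k-1}\frac{f_\lambda(l,x)}{f_\lambda}\right)=\frac{\prod_{y\in\lambda}h_\lambda(y)}{n-k+1}\sum_{l=k}^n f_\lambda(l,x).$$
   Context: A partition $\lambda\vdash n$ is identified with its Young diagram $\{(i,j): i\ge1,\ 1\le j\le\lambda_i\}$; $\lambda'$ is the conjugate. The hook length of $x=(i,j)$ is $h_\lambda(x)=(\lambda_i-j)+(\lambda'_j-i)+1$. A tabloid is a bijection $T:\lambda\to\{1,\dots,n\}$; $\operatorname{T}(\lambda)$ is the set of tabloids. A standard Young tableau is a tabloid with entries increasing along rows and down columns; $f_\lambda$ is their number and $f_\lambda(k,x)$ the number with entry $k$ in cell $x$. Order cells by $(i,j)\prec(k,l)$ iff $j<l$, or $j=l$ and $i<k$; list them $z_1\prec\dots\prec z_n$. Novelli--Pak--Stoyanovskii sorting of $T$: $T_{z_n}:=T$; for $m=n-1,\dots,1$, $T_{z_m}$ is obtained from $T_{z_{m+1}}$ by the slide at $z_m$: the entry in $z_m$ is repeatedly exchanged with the smaller of the entries in its current right and bottom neighbours as long as that entry is smaller than it. Drop function: $d_\lambda(k,x)$ is the number of $T\in\operatorname{T}(\lambda)$ such that, with $z$ the cell with $T(z)=k$, one has $T_z(x)=k$ (the entry $k$ is moved to $x$ by its own slide). *)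

(* Defs.v *)
From mathcomp Require Import all_boot all_order all_algebra.
Set Implicit Arguments. Unset Strict Implicit. Unset Printing Implicit Defensive.

(* Cells are pairs (i,j) of naturals, 1-indexed as in the paper:
   row i >= 1, column j with 1 <= j <= lambda_i. *)
Definition cell := (nat * nat)%type.

Definition is_partition_of (lam : seq nat) (n : nat) : bool :=
  [&& sorted geq lam, 0 \notin lam & sumn lam == n].

Definition part (lam : seq nat) (i : nat) : nat := nth 0 lam i.-1.

Definition conjp (lam : seq nat) (j : nat) : nat := count (fun r => j <= r) lam.

Definition in_diag (lam : seq nat) (c : cell) : bool :=
  [&& 0 < c.1, 0 < c.2 & c.2 <= part lam c.1].

Definition hook (lam : seq nat) (c : cell) : nat :=
  (part lam c.1 - c.2) + (conjp lam c.2 - c.1) + 1.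

Definition cells (lam : seq nat) : seq cell :=
  [seq (i, j) | j <- iota 1 (head 0 lam), i <- iota 1 (conjp lam j)].

(* fillings of the plane by naturals (only values on the diagram matter) *)
Definition filling := cell -> nat.

Definition swapf (U : filling) (p q : cell) : filling :=
  fun c => if c == p then U q else if c == q then U p else U c.

Definition slide_step (lam : seq nat) (U : filling) (p : cell)
  : option (filling * cell) :=
  let r := (p.1, p.2.+1) in
  let b := (p.1.+1, p.2) in
  let cand :=
    match in_diag lam r, in_diag lam b with
    | true, true => Some (if U r < U b then r else b)
    | true, false => Some r
    | false, true => Some b
    | false, false => None
    end in
  match cand with
  | Some m => if U m < U p then Some (swapf U p m, m) else None
  | None => None
  end.

Fixpoint slide_aux (lam : seq nat) (fuel : nat) (U : filling) (p : cell)
  : filling :=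
  match fuel with
  | 0 => U
  | f.+1 => match slide_step lam U p with
            | Some (U', p') => slide_aux lam f U' p'
            | None => U
            end
  end.

(* the slide at z.  Every exchange moves the entry to a cell of strictly
   larger i + j inside lambda, so at most sumn lam exchanges can occur:
   the fuel sumn lam is sufficient and the slide is run to completion. *)
Definition slide (lam : seq nat) (z : cell) (U : filling) : filling :=
  slide_aux lam (sumn lam) U z.

Fixpoint nps_from (lam : seq nat) (s : seq cell) (T : filling) : filling :=
  match s with
  | [::] => T
  | [:: _] => T
  | z :: s' => slide lam z (nps_from lam s' T)
  end.

Definition nps_at (lam : seq nat) (T : filling) (z : cell) : filling :=
  nps_from lam (drop (index z (cells lam)) (cells lam)) T.

(* Finite carrier for tabloids of lambda |- n: every cell of lambda has both
   coordinates <= n, so a tabloid is encoded by a finite function on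
   'I_n.+1 * 'I_n.+1 with values in 'I_n.+1 (value 0 off the diagram). *)
Definition tabtype (n : nat) := {ffun 'I_n.+1 * 'I_n.+1 -> 'I_n.+1}.

Definition tof (n : nat) (T : tabtype n) : filling :=
  fun c => if (c.1 < n.+1) && (c.2 < n.+1)
           then nat_of_ord (T (inord c.1, inord c.2)) else 0.

(* T is a tabloid: restricted to lambda it is a bijection onto {1,...,n};
   it is 0 outside lambda (canonical representative) *)
Definition is_tabloid (lam : seq nat) (n : nat) (T : tabtype n) : bool :=
  [&& perm_eq [seq tof T c | c <- cells lam] (iota 1 n) &
      [forall c : 'I_n.+1 * 'I_n.+1,
         ~~ in_diag lam (nat_of_ord c.1, nat_of_ord c.2) ==> (T c == ord0)]].

Definition is_syt (lam : seq nat) (n : nat) (T : tabtype n) : bool :=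
  is_tabloid lam T &&
  all (fun c =>
         (in_diag lam (c.1, c.2.+1) ==> (tof T c < tof T (c.1, c.2.+1))) &&
         (in_diag lam (c.1.+1, c.2) ==> (tof T c < tof T (c.1.+1, c.2))))
      (cells lam).

Definition fsyt (lam : seq nat) : nat :=
  #|[set T : tabtype (sumn lam) | is_syt lam T]|.

Definition fsyt_at (lam : seq nat) (k : nat) (x : cell) : nat :=
  #|[set T : tabtype (sumn lam) | is_syt lam T && (tof T x == k)]|.

Definition dropf (lam : seq nat) (k : nat) (x : cell) : nat :=
  #|[set T : tabtype (sumn lam) | is_tabloid lam T &&
       has (fun z => (tof T z == k) && (nps_at lam (tof T) z x == k))
           (cells lam)]|.

(* Main.v *)
(** Two facts combine.

    Uniformity: every standard tableau is the result of exactly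
    [\prod_y hook y] tabloids.  Sort the cells down to [z = (i, j)], and let
    [r] be the length of column [j].  The number of tabloids leading to a given
    state [V] is the product of the hook lengths of the columns right of [j]
    and of the factors [r - h + a_h(V)], [i <= h <= r], where [a_h(V)] counts
    the cells of row [h] whose reverse slide path in [V] ends in [z].  The
    preimages of [V] under the slide at [z] correspond to the cells [y] whose
    reverse path ends in [z]; undoing the slide along that path replaces
    [a_(h+1)] by [1 + c_h(y)] above the row of [y] and [a_h] by [c_h(y)] below
    it, where [c_h(y)] counts the cells of row [h] that precede [y] in the
    in-order traversal of the binary tree of reverse paths.  Summing over [y]
    in that order telescopes.  At the top of a column [a_h] is the whole arm,
    so that the factors are hook lengths.

    Drops: count the moves of the entry [k] by the entry [b > k] that performs
    them.  Exchanging [b] and [b+1] in a tabloid shows that the total change of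
    [k in x] during the slide of [b] does not depend on [b > k], and comparing
    [k] with [k+1] in the same way shows that it is [d(k,x) - d(k+1,x)].  Hence
    [#{T | k ends in x} = d(k,x) + (n-k) (d(k,x) - d(k+1,x))]. *)
Require Import Defs.
From mathcomp Require Import all_boot all_order all_algebra.
From mathcomp Require Import zify.
From Stdlib Require Import FunctionalExtensionality.
Set Implicit Arguments. Unset Strict Implicit. Unset Printing Implicit Defensive.

(** * Reverse slide paths *)

Definition lft (c : cell) : cell := (c.1, c.2.-1).
Definition abv (c : cell) : cell := (c.1.-1, c.2).
Definition rgt (c : cell) : cell := (c.1, c.2.+1).
Definition blw (c : cell) : cell := (c.1.+1, c.2).

Definition rank (c : cell) : nat := c.1 + c.2.

(* [G] is positive exactly on the sorted cells, so that [parent] never leaves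
   them while a neighbour is available. *)
Definition parent (G : cell -> nat) (c : cell) : cell :=
  if G (abv c) < G (lft c) then lft c else abv c.

(** A step of [parent] that stays weakly below and to the right of [z] lowers the rank by exactly
    one, so [rank c - rank z] is the only number of steps that can lead from [c] to [z]. *)
Definition reaches (G : cell -> nat) (z c : cell) : bool :=
  [&& z.1 <= c.1, z.2 <= c.2 & iter (rank c - rank z) (parent G) c == z].

(** A path ending in [z] meets each rank between those of its ends exactly once, so membership is a
    test on a single iterate. *)
Definition on_path (G : cell -> nat) (z y c : cell) : bool :=
  [&& rank z <= rank c, rank c <= rank y &
      iter (rank y - rank c) (parent G) y == c].

Section Paths.
Variables (G : cell -> nat) (z : cell).
Local Notation par := (parent G).
Local Notation reach := (reaches G z).
Local Notation onpath := (on_path G z).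

Lemma par_cases c : par c = lft c \/ par c = abv c.
Proof. by rewrite /parent; case: ifP; [left|right]. Qed.

Lemma iter_par_le k c :
  (iter k par c).1 <= c.1 /\ (iter k par c).2 <= c.2.
Proof.
elim: k => [|k [IH1 IH2]] //=.
by case: (par_cases (iter k par c)) => -> /=; lia.
Qed.

(** Truncated predecessors can make the two neighbours coincide in row 0; in a positive row a step
    to the left really decides the comparison. *)
Lemma par_lft c : 0 < c.1 -> par c = lft c -> G (abv c) < G (lft c).
Proof.
move=> c1; rewrite /parent; case: ifP => // _ [e].
by move: c1; rewrite -e; lia.
Qed.

Hypotheses (z1 : 0 < z.1) (z2 : 0 < z.2).

Lemma reach_ge c : reach c -> z.1 <= c.1 /\ z.2 <= c.2.
Proof. by case/and3P. Qed.

Lemma reach_root : reach z.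
Proof. by rewrite /reaches subnn /= !leqnn eqxx. Qed.

Lemma rank_par c : z.1 <= (par c).1 -> z.2 <= (par c).2 ->
  rank c = (rank (par c)).+1.
Proof. by rewrite /rank; case: (par_cases c) => -> /=; lia. Qed.

Lemma reach_par c : reach c -> c <> z -> reach (par c).
Proof.
move=> /and3P[h1 h2 /eqP e] ne.
have lt : rank z < rank c.
  case: c z h1 h2 ne {e} => [a b] [a' b'] /=; rewrite /rank /= => h1 h2 ne.
  have : ~ (a = a' /\ b = b') by case=> ? ?; apply: ne; congr pair.
  lia.
have [d ed] : exists d, rank c - rank z = d.+1.
  by exists (rank c - rank z).-1; lia.
move: e; rewrite ed iterSr => e.
have [l1 l2] := iter_par_le d (par c); rewrite e in l1 l2.
rewrite /reaches l1 l2 /=; have := rank_par l1 l2.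
by move=> er; rewrite -[X in iter X](_ : d = _) ?e //; lia.
Qed.

Lemma reach_of_par c : reach (par c) -> reach c.
Proof.
move=> /and3P[h1 h2 /eqP e]; have er := rank_par h1 h2.
have [l1 l2] := iter_par_le 1 c; rewrite /= in l1 l2.
rewrite /reaches (leq_trans h1 l1) (leq_trans h2 l2) /=.
have le : rank z <= rank (par c) by rewrite /rank; lia.
by rewrite er subSn // iterSr e.
Qed.

Section OnePath.
Variable y : cell.
Hypothesis ry : reach y.
Local Notation P := (onpath y).

Lemma rank_le_reach : rank z <= rank y.
Proof. by have [] := reach_ge ry; rewrite /rank; lia. Qed.

Lemma onpath_refl : P y.
Proof. by rewrite /on_path subnn /= eqxx leqnn rank_le_reach. Qed.

Lemma reach_iter k : k <= rank y - rank z ->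
  reach (iter k par y) /\ rank (iter k par y) = rank y - k.
Proof.
elim: k => [|k IH] lk; first by rewrite /= subn0.
have [r er] := IH (ltnW lk).
have ne : iter k par y <> z by move=> e; move: er lk; rewrite e; lia.
rewrite iterS; have rp := reach_par r ne; split=> //.
by have [p1 p2] := reach_ge rp; have := rank_par p1 p2; lia.
Qed.

Lemma onpathP c : reflect (exists2 k, k <= rank y - rank z & c = iter k par y)
  (P c).
Proof.
apply: (iffP and3P) => [[h1 h2 /eqP e]|[k lk ->]].
  by exists (rank y - rank c); [lia|].
have [_ er] := reach_iter lk; have := rank_le_reach => ?.
have le : k <= rank y by lia.
by rewrite er; split; [lia|lia|rewrite subKn].
Qed.

Lemma onpath_reach c : P c -> reach c.
Proof. by case/onpathP=> k lk ->; case: (reach_iter lk). Qed.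

Lemma onpath_root : P z.
Proof.
have /and3P[_ _ /eqP e] := ry.
by apply/onpathP; exists (rank y - rank z); rewrite ?e.
Qed.

Lemma onpath_par c : P c -> c <> z -> P (par c).
Proof.
move=> /onpathP[k lk ec] ne; apply/onpathP; exists k.+1; last by rewrite ec.
case: (ltngtP k (rank y - rank z)) lk => // ek _.
by have /and3P[_ _ /eqP e] := ry; case: ne; rewrite ec ek e.
Qed.

Lemma onpath_child c : P c -> c <> y ->
  exists2 d, P d & par d = c /\ (d = rgt c \/ d = blw c).
Proof.
move=> /onpathP[[|k] lk ec] ne; first by case: ne.
exists (iter k par y); first by apply/onpathP; exists k => //; lia.
rewrite -iterS -ec; split=> //.
have [r _] := reach_iter lk.
rewrite -ec in r.
have epar : par (iter k par y) = c by rewrite -iterS ec.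
have [g1 g2] := reach_ge r.
move: (iter k par y) epar => [a b].
case: (par_cases (a, b)) => -> e; [left|right]; rewrite -e in g1 g2 *;
  rewrite /rgt /blw /lft /abv /= in g1 g2 *; congr pair; lia.
Qed.

Lemma onpath_le c d : P c -> P d -> rank c <= rank d -> c.1 <= d.1 /\ c.2 <= d.2.
Proof.
move=> /and3P[_ _ /eqP ec] /and3P[h1 h2 /eqP ed] le.
have <- : iter (rank d - rank c) par d = c; last exact: iter_par_le.
by rewrite -{2}ed -iterD -[RHS]ec; congr iter; lia.
Qed.

Lemma onpath_chain c d : P c -> P d ->
  (c.1 <= d.1 /\ c.2 <= d.2) \/ (d.1 <= c.1 /\ d.2 <= c.2).
Proof.
move=> pc pd; case: (leqP (rank c) (rank d)) => le; [left|right].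
  exact: onpath_le.
by apply: onpath_le => //; apply: ltnW.
Qed.

Lemma onpath_end c : P c -> c.1 <= y.1 /\ c.2 <= y.2.
Proof. by move=> pc; apply: onpath_le onpath_refl _ => //; case/and3P: pc. Qed.

Lemma onpath_ge c : P c -> z.1 <= c.1 /\ z.2 <= c.2.
Proof. by move/onpath_reach/reach_ge. Qed.

Lemma onpath_sub c d : P c -> rank d <= rank c -> onpath c d = P d.
Proof.
move=> pc le; rewrite /on_path; case/and3P: pc => h1 h2 /eqP ec.
rewrite le (leq_trans le h2) /= -{2}ec -iterD.
by congr (_ && (iter _ _ _ == _)); lia.
Qed.

(** The path has to leave column [m] to get to column [z.2]; climbing from [(t, m)], it turns left
    in row [t0]. *)
Lemma onpath_top t m : P (t, m) -> z.2 < m ->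
  exists2 t0, t0 <= t &
    [/\ P (t0, m), P (t0, m.-1) & par (t0, m) = (t0, m.-1)].
Proof.
elim: t => [|t IH] p lt.
  by have [] := onpath_ge p => /=; lia.
have ne : (t.+1, m) <> z by move=> e; rewrite -e ltnn in lt.
have pp := onpath_par p ne.
case: (par_cases (t.+1, m)) => e.
  by exists t.+1 => //; rewrite e /lft /= in pp *.
rewrite e in pp; have [t0 l0 h] := IH pp lt.
by exists t0 => //; apply: leqW.
Qed.

Lemma onpath_col t m m' : P (t, m) -> z.2 <= m' -> m' <= m ->
  exists2 t', t' <= t & P (t', m').
Proof.
move=> p lz; elim: m t p => [|m IH] t p lm.
  by move: lm; rewrite leqn0 => /eqP ->; exists t.
case: (ltngtP m' m.+1) lm => // [lm _|-> _]; last by exists t.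
have lt : z.2 < m.+1 by lia.
have [t0 l0 [_ p0 _]] := onpath_top p lt.
have [t' l' p'] := IH t0 p0 lm.
by exists t' => //; apply: leq_trans l0.
Qed.

Lemma onpath_row g : z.1 <= g -> g <= y.1 -> exists m, P (g, m).
Proof.
move=> lz; have : exists2 m, m <= y.2 & P (y.1, m).
  by exists y.2 => //; case: y onpath_refl.
case=> m _; elim: (y.1) m => [|k IH] m p lg.
  by exists m; move: lg; rewrite leqn0 => /eqP ->.
case: (ltngtP g k.+1) lg => // [lg _|-> _]; last by exists m.
elim: m p => [|m IHm] p; first by have [] := onpath_ge p => /=; lia.
have ne : (k.+1, m.+1) <> z by move=> e; rewrite -e /= in lz; lia.
have := onpath_par p ne.
by case: (par_cases (k.+1, m.+1)) => ->; rewrite /lft /abv /= => q;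
  [apply: IHm|apply: IH q _].
Qed.

End OnePath.

(* Rightmost column of the path of [y] in row [g]. *)
Definition rcol (y : cell) (g : nat) : nat :=
  \max_(m < y.2.+1 | onpath y (g, val m)) m.

Lemma rcol_max y g m : reach y -> onpath y (g, m) -> m <= rcol y g.
Proof.
move=> ry p; have [_ /= le] := onpath_end ry p.
have lt : m < y.2.+1 by [].
exact: (@leq_bigmax_cond _ (fun m : 'I__ => onpath y (g, val m))
  (fun m : 'I__ => val m) (Ordinal lt)).
Qed.

Lemma onpath_rcol y g : reach y -> z.1 <= g -> g <= y.1 -> onpath y (g, rcol y g).
Proof.
move=> ry lz ly; have [m p] := onpath_row ry lz ly.
have [_ /= le] := onpath_end ry p.
have lt : m < y.2.+1 by [].
rewrite /rcol; have [| m0 pm0 ->] := @eq_bigmax_cond _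
  (fun m : 'I_(y.2.+1) => onpath y (g, val m)) (fun m : 'I__ => val m).
  by apply/card_gt0P; exists (Ordinal lt).
exact: pm0.
Qed.

Lemma rcol_unique y g e : reach y -> z.1 <= g -> g <= y.1 -> onpath y (g, e) ->
  (forall m, onpath y (g, m) -> m <= e) -> rcol y g = e.
Proof.
move=> ry lz ly p h; apply/eqP; rewrite eqn_leq h ?rcol_max //.
exact: onpath_rcol.
Qed.

Lemma rcol_self y : reach y -> rcol y y.1 = y.2.
Proof.
move=> ry; have [? ?] := reach_ge ry; apply: rcol_unique => //.
  by have := onpath_refl ry; case: (y).
by move=> m p; have [] := onpath_end ry p.
Qed.

(** The path continues towards [y] from its rightmost cell in row [g]; it cannot go on to the right
    in that row, so it goes down. *)
Lemma onpath_below_rcol y g : reach y -> z.1 <= g -> g < y.1 ->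
  onpath y (g.+1, rcol y g).
Proof.
move=> ry lz ly; have p := onpath_rcol ry lz (ltnW ly).
have ne : (g, rcol y g) <> y by move=> e; rewrite -e ltnn in ly.
have [d pd [_ [e|e]]] := onpath_child ry p ne; rewrite e in pd => //.
by have := rcol_max ry pd; rewrite /= ltnn.
Qed.

Lemma rcol_bound y g t m : reach y -> z.1 <= g -> g <= y.1 -> t <= g ->
  onpath y (t, m) -> m <= rcol y g.
Proof.
move=> ry lz ly lt p; case: (ltngtP t g) lt => // [lt _|e _].
  by case: (onpath_chain ry p (onpath_rcol ry lz ly)) => /= -[] //; lia.
by apply: rcol_max => //; rewrite -e.
Qed.

(** The part of the path of [y] between [z] and its last cell in row [g] is the whole path of that
    cell, since both follow [parent]. *)
Lemma rcol_comp y f g : reach y -> z.1 <= f -> f <= g -> g <= y.1 ->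
  rcol y f = rcol (g, rcol y g) f.
Proof.
move=> ry lz lf ly; have lzg := leq_trans lz lf.
have p := onpath_rcol ry lzg ly; have rp := onpath_reach ry p.
have lfy := leq_trans lf ly.
symmetry; apply: rcol_unique => //.
  rewrite (onpath_sub ry p) ?onpath_rcol //.
  by have := @rcol_bound y g f (rcol y f) ry lzg ly lf (onpath_rcol ry lz lfy);
    rewrite /rank /=; lia.
move=> m pm; apply: rcol_max => //; rewrite -(onpath_sub ry p) //.
by case/and3P: pm.
Qed.

End Paths.

(** * Non-crossing of reverse paths and the traversal order *)

Definition col_le (z c : cell) : bool :=
  (z.2 < c.2) || ((z.2 == c.2) && (z.1 <= c.1)).

(* The in-order traversal of the tree of reverse paths: the cells reached
   through the lower neighbour come first, then the cell itself, then those
   reached through the right neighbour. *)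
Definition path_lt (G : cell -> nat) (z w y : cell) : bool :=
  if y.1 < w.1 then rcol G z w y.1 <= y.2 else w.2 < rcol G z y w.1.

(* The labels after undoing the slide from [z] to [y]; [z] leaves the sorted
   region. *)
Definition shifted (G : cell -> nat) (z y c : cell) : nat :=
  if c == z then 0 else if on_path G z y c then G (parent G c) else G c.

Section Region.
Variables (D : pred cell) (G : cell -> nat) (z : cell).
Hypotheses (D_gt0 : forall c, D c -> 0 < c.1 /\ 0 < c.2).
Hypothesis D_down : forall a b a' b', D (a, b) -> 0 < a' -> a' <= a ->
  0 < b' -> b' <= b -> D (a', b').
Hypothesis Dz : D z.
Hypothesis G_supp : forall c, (0 < G c) = D c && col_le z c.

Local Notation par := (parent G).
Local Notation reach := (reaches G z).
Local Notation P := (on_path G z).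
Local Notation rc := (rcol G z).
Local Notation lt := (path_lt G z).

Let z1 : 0 < z.1. Proof. by case: (D_gt0 Dz). Qed.
Let z2 : 0 < z.2. Proof. by case: (D_gt0 Dz). Qed.

(** Non-crossing is expressed by the invariance of this condition under [parent]. *)
Definition weakly_below (y c : cell) : Prop :=
  exists2 t, t <= c.1 & P y (t, c.2).

(** A cell on the path of [y] continues along it. From a cell strictly below, a step up stays weakly
    below, and a step to the left does too because the path crosses the next column no lower than
    this one. *)
Lemma weakly_below_par y c : reach y -> D c -> weakly_below y c -> c <> z ->
  D (par c) /\ weakly_below y (par c).
Proof.
move=> ry Dc [t lt p] ne; have [t1 t2] := onpath_ge z1 z2 ry p.
rewrite /= in t1 t2.
suff wb : weakly_below y (par c).
  split=> //; case: wb => t' lt' /(onpath_ge z1 z2 ry) /= [g1 g2].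
  have [l1 l2] := iter_par_le G 1 c; rewrite /= in l1 l2.
  move: c Dc l1 l2 {lt p ne t2} lt' g1 g2 => [a' b'] Dc.
  by case: (par _) => a b /= *; apply: (D_down Dc) => //=; lia.
case: (ltngtP t c.1) lt => // [lt _|e _].
  case: (par_cases G c) => e; rewrite e; last first.
    by exists t => //=; lia.
  case: (ltngtP z.2 c.2) => [l|l|e2].
  - by have [t0 l0 [_ p0 _]] := onpath_top z1 z2 ry p l; exists t0 => //=; lia.
  - lia.
  (* A step to the left out of column [z.2] would need a positive label there, but the cells left of
     that column are unsorted. *)
  - exfalso; have : 0 < G (lft c) by have := par_lft _ e; lia.
    by rewrite G_supp /col_le /=; lia.
have pc : P y c by move: p; rewrite e; case: (c).
have pp := onpath_par z1 z2 ry pc ne.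
by exists (par c).1 => //; case: (par c) pp.
Qed.

(** Following [parent], the rank falls while the cell stays caught below the path of [y], and only
    [z] stops this. *)
Lemma weakly_below_reach y c : reach y -> D c -> weakly_below y c -> reach c.
Proof.
move=> ry; have [n] := ubnP (rank c); elim: n c => // n IH c lc Dc wb.
have [->|/eqP ne] := eqVneq c z; first exact: reach_root.
have [Dp wp] := weakly_below_par ry Dc wb ne.
apply: reach_of_par => //; apply: IH => //.
case: wp => t lt /(onpath_ge z1 z2 ry) /= [g1 g2].
have := @rank_par G z z1 z2 c; lia.
Qed.

Lemma D_reach_ge c a b : D c -> z.1 <= a -> a <= c.1 -> z.2 <= b -> b <= c.2 ->
  D (a, b).
Proof. by case: c => x y Dc *; apply: (D_down Dc) => //=; lia. Qed.

Lemma onpath_D y c : reach y -> D y -> P y c -> D c.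
Proof.
move=> ry Dy p; have [g1 g2] := onpath_ge z1 z2 ry p.
have [e1 e2] := onpath_end z1 z2 ry p.
by case: c {p} g1 g2 e1 e2 => a b *; apply: (D_reach_ge Dy).
Qed.

Lemma weakly_below_onpath y w c : reach y -> D w -> weakly_below y w ->
  P w c -> weakly_below y c.
Proof.
move=> ry Dw wb; have rw := weakly_below_reach ry Dw wb.
case/(onpathP z1 z2 rw) => k lk ->.
suff [] : weakly_below y (iter k par w) /\ D (iter k par w) by [].
elim: k lk => [|k IH] lk //=.
have [b d] := IH (ltnW lk).
have ne : iter k par w <> z.
  by move=> e; have [_] := reach_iter z1 z2 rw (ltnW lk); rewrite e; lia.
by have [] := weakly_below_par ry d b ne.
Qed.

Lemma row_weakly_below y m m' : reach y -> z.2 <= m' -> m' <= m ->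
  forall g, P y (g, m) -> weakly_below y (g, m').
Proof.
by move=> ry l1 l2 g p; have [t lt pt] := onpath_col z1 z2 ry p l1 l2; exists t.
Qed.

(* Reverse paths do not cross. *)
Lemma rcol_mono h m m' g : D (h, m') -> reach (h, m') -> reach (h, m) ->
  m <= m' -> z.1 <= g -> g <= h -> rc (h, m) g <= rc (h, m') g.
Proof.
move=> Dy ry rw lm lz lh; have [_ /= zm] := reach_ge rw.
have [/= h1 h2] := reach_ge ry.
have Dw : D (h, m) by apply: (D_reach_ge Dy).
have wb : weakly_below (h, m') (h, m).
  by apply: (@row_weakly_below _ m') => //; apply: onpath_refl.
have p := onpath_rcol z1 z2 rw lz lh.
have [t lt pt] := weakly_below_onpath ry Dw wb p.
exact: (rcol_bound z1 z2 ry lz lh lt pt).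
Qed.

Lemma path_lt_total w y : reach w -> reach y -> w != y -> lt w y || lt y w.
Proof.
move=> rw ry ne; rewrite /path_lt.
case: (ltngtP w.1 y.1) => e; [lia|lia|].
rewrite e rcol_self // -e rcol_self //.
have : w.2 != y.2.
  apply: contraNneq ne => e2.
  by rewrite [w]surjective_pairing [y]surjective_pairing e e2.
lia.
Qed.

Lemma path_lt_asym w y : reach w -> reach y -> lt w y -> ~~ lt y w.
Proof.
move=> rw ry; rewrite /path_lt.
case: (ltngtP w.1 y.1) => e; [lia|lia|].
by rewrite e rcol_self // -e rcol_self //; lia.
Qed.

Lemma rcol_reach w g : reach w -> z.1 <= g -> g <= w.1 -> reach (g, rc w g).
Proof.
by move=> rw l1 l2; apply: (onpath_reach z1 z2 rw); apply: onpath_rcol. Qed.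

Lemma rcol_D w g : reach w -> D w -> z.1 <= g -> g <= w.1 -> D (g, rc w g).
Proof. by move=> rw Dw l1 l2; apply: (@onpath_D w) => //; apply: onpath_rcol. Qed.

(** [path_lt] compares two cells in the upper one of their rows. In each arrangement of the three
    rows, [rcol_comp] carries the comparisons to a common row and [rcol_mono] shows that they are
    consistent there. *)
Lemma path_lt_trans w1 w2 w3 : reach w1 -> reach w2 -> reach w3 ->
  D w1 -> D w2 -> D w3 -> lt w1 w2 -> lt w2 w3 -> lt w1 w3.
Proof.
move: w1 w2 w3 => [h1 m1] [h2 m2] [h3 m3] r1 r2 r3 d1 d2 d3.
have [[[/= g1 _] [/= g2 _]] [/= g3 _]] := (reach_ge r1, reach_ge r2, reach_ge r3).
rewrite /path_lt /=.
case: (ltnP h2 h1) => l12 a; case: (ltnP h3 h2) => l23 b.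
- rewrite (ltn_trans l23 l12) (rcol_comp z1 z2 r1 g3 (ltnW l23) (ltnW l12)) /=.
  apply: leq_trans b; apply: rcol_mono => //; last exact: ltnW.
  by apply: rcol_reach => //; apply: ltnW.
- case: (ltnP h3 h1) => l13.
    rewrite leqNgt; apply/negP => lt3.
    have q := rcol_reach r1 g3 (ltnW l13).
    have dq := rcol_D r1 d1 g3 (ltnW l13).
    have := rcol_mono dq q r3 (ltnW lt3) g2 l23.
    by rewrite -(rcol_comp z1 z2 r1 g2 l23 (ltnW l13)); lia.
  rewrite ltnNge; apply/negP => le.
  have q := rcol_reach r3 g1 l13.
  have := rcol_mono d1 r1 q le g2 (ltnW l12).
  by rewrite -(rcol_comp z1 z2 r3 g2 (ltnW l12) l13); lia.
- case: (ltnP h3 h1) => l13.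
    have q := rcol_reach r2 g1 l12.
    have dq := rcol_D r2 d2 g1 l12.
    have := rcol_mono dq q r1 (ltnW a) g3 (ltnW l13).
    by rewrite -(rcol_comp z1 z2 r2 g3 (ltnW l13) l12); lia.
  have q := rcol_reach r2 g3 (ltnW l23).
  have := rcol_mono d3 r3 q b g1 l13.
  by rewrite -(rcol_comp z1 z2 r2 g1 l13 (ltnW l23)); lia.
- case: (ltnP h3 h1) => l13; first lia.
  have q := rcol_reach r3 g2 l23.
  have dq := rcol_D r3 d3 g2 l23.
  have := rcol_mono dq q r2 (ltnW b) g1 l12.
  by rewrite -(rcol_comp z1 z2 r3 g1 l12 l23); lia.
Qed.

End Region.

(** * Reverse paths after a slide has been undone *)

Lemma count_iota_range a b p : 0 < a -> b <= p.+1 ->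
  count (fun m => a <= m < b) (iota 1 p) = b - a.
Proof.
move=> a0; elim: p b => [|p IH] b lb.
  by rewrite /=; lia.
have -> : iota 1 p.+1 = iota 1 p ++ [:: p.+1] by rewrite -[X in iota 1 X]addn1 iotaD.
rewrite count_cat /= addn0.
case: (ltngtP b p.+2) lb => // [lb _|-> _].
  by rewrite IH //; lia.
rewrite -(@eq_in_count _ (fun m => a <= m < p.+1)).
  by rewrite IH //; lia.
by move=> m; rewrite mem_iota; lia.
Qed.

(** Stepping down from [z] removes just [z] from the sorted region, also at the foot of a column,
    where [blw z] is outside the diagram. *)
Lemma col_le_blw z c : col_le (blw z) c = col_le z c && (c != z).
Proof.
rewrite /col_le /=; case: c z => a b [a' b'] /=.
by rewrite -pair_eqE /=; lia.
Qed.

Section Shift.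
Variables (D : pred cell) (wd : nat -> nat) (G : cell -> nat) (z : cell).
Hypothesis D_wd : forall h m, D (h, m) = [&& 0 < h, 0 < m & m <= wd h].
Hypothesis wd_anti : forall h, 0 < h -> wd h.+1 <= wd h.

Lemma wd_gt0 c : D c -> 0 < c.1 /\ 0 < c.2.
Proof. by case: c => a b; rewrite D_wd => /and3P[]. Qed.

Lemma wd_down a b a' b' : D (a, b) -> 0 < a' -> a' <= a -> 0 < b' -> b' <= b ->
  D (a', b').
Proof.
rewrite !D_wd => /and3P[a0 b0 lb] a'0 la b'0 lb'; rewrite a'0 b'0.
apply: (leq_trans lb'); apply: (leq_trans lb).
rewrite -(subnKC la); elim: (a - a') => [|k IH]; first by rewrite addn0.
by rewrite addnS; apply: leq_trans (wd_anti _) IH; lia.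
Qed.

Hypothesis Dz : D z.
Hypothesis G_supp : forall c, (0 < G c) = D c && col_le z c.
Hypothesis G_rgt : forall c, 0 < G c -> D (rgt c) -> G c < G (rgt c).
Hypothesis G_blw : forall c, 0 < G c -> D (blw c) -> G c < G (blw c).

Local Notation par := (parent G).
Local Notation reach := (reaches G z).
Local Notation P := (on_path G z).
Local Notation rc := (rcol G z).
Local Notation lt := (path_lt G z).

Let z1 : 0 < z.1. Proof. by case: (wd_gt0 Dz). Qed.
Let z2 : 0 < z.2. Proof. by case: (wd_gt0 Dz). Qed.

Variable y : cell.
Hypotheses (ry : reach y) (Dy : D y).

Local Notation z' := (blw z).
Local Notation G' := (shifted G z y).
Local Notation par' := (parent G').
Local Notation reach' := (reaches G' z').

Let z1' : 0 < z'.1. Proof. by []. Qed.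
Let z2' : 0 < z'.2. Proof. exact: z2. Qed.

Let DP c : P y c -> D c.
Proof. exact: (onpath_D wd_gt0 wd_down Dz ry Dy). Qed.

Let Dge c a b : D c -> z.1 <= a -> a <= c.1 -> z.2 <= b -> b <= c.2 -> D (a, b).
Proof. exact: (D_reach_ge wd_gt0 wd_down Dz). Qed.

Let Gpath c : P y c -> 0 < G c.
Proof.
move=> p; rewrite G_supp DP //=; have [? ?] := onpath_ge z1 z2 ry p.
by rewrite /col_le; lia.
Qed.

Lemma shifted_supp c : (0 < G' c) = D c && col_le z' c.
Proof.
rewrite col_le_blw /shifted; case: eqVneq => [_|ne]; first by rewrite !andbF.
rewrite andbT -G_supp; case: ifP => // p.
by rewrite !Gpath //; apply: onpath_par => //; apply/eqP.
Qed.

(** Down to row [y.1], these turn out to be exactly the cells of the diagram that reach [blw z] for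
    the shifted labels. *)
Definition strictly_below (c : cell) : Prop :=
  exists2 t, t < c.1 & P y (t, c.2).

(** The only danger is a step up onto a path cell with no path cell above it in its column. The path
    then turns left at that cell, and the shifted labels force a step to the left instead. *)
Lemma strictly_below_par c : D c -> strictly_below c -> c <> z' ->
  D (par' c) /\ strictly_below (par' c).
Proof.
move=> Dc [t lt p] ne; have [/= t1 t2] := onpath_ge z1 z2 ry p.
suff sb : strictly_below (par' c).
  split=> //; case: sb => t' lt' /(onpath_ge z1 z2 ry) /= [g1 g2].
  have [l1 l2] := iter_par_le G' 1 c; rewrite /= in l1 l2.
  by case: (par' c) lt' g1 g2 l1 l2 => a b /= *; apply: (Dge Dc) => //; lia.
case: c Dc lt p ne t2 => h m /= Dc lt p ne t2.
case: (par_cases G' (h, m)) => e; rewrite e /strictly_below /=.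
  have : 0 < G' (lft (h, m)) by have := par_lft _ e; rewrite /=; lia.
  rewrite shifted_supp /col_le /= => /andP[_ h2].
  have [||t0 l0 p0] := onpath_col z1 z2 ry p (_ : z.2 <= m.-1); [lia|lia|].
  by exists t0 => //; lia.
case: (ltngtP t h.-1) => et; [by exists t|lia|].
case: (ltngtP z.2 m) => lm; [|lia|]; last first.
  exists z.1; last by rewrite -lm -surjective_pairing onpath_root.
  have : z.1 <> h.-1.
    by move=> ez; apply: ne; rewrite /blw lm ez; congr pair; lia.
  lia.
have [t0 l0 [p0 p0' e0]] := onpath_top z1 z2 ry p lm.
case: (ltngtP t0 t) l0 => // [l0 _|e1 _]; first by exists t0 => //; lia.
(* The path cell [(t, m)] above has received the label of [(t, m.-1)], which is smaller than that of
   [(h, m.-1)] just below it; so [par'] would go left. *)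
subst t0; exfalso.
have Ga : G' (abv (h, m)) = G (t, m.-1).
  rewrite /abv /= -et /shifted p e0.
  by case: eqVneq => // ez; rewrite -ez ltnn in lm.
have Gl : G' (lft (h, m)) = G (h, m.-1).
  rewrite /lft /shifted /=; case: eqVneq => ez.
    by move: t1; rewrite -ez /=; lia.
  case: ifP => // pl; have := onpath_chain z1 z2 ry pl p; rewrite /=; lia.
have : G (t, m.-1) < G (h, m.-1).
  have eh : h = t.+1 by lia.
  rewrite eh; apply: (G_blw (Gpath p0')); rewrite /blw /= -eh.
  by apply: (Dge Dc) => /=; lia.
move: e; rewrite /parent Ga Gl => e lG; move: e; rewrite lG => -[]; lia.
Qed.

Lemma strictly_below_reach c : D c -> strictly_below c -> reach' c.
Proof.
have [n] := ubnP (rank c); elim: n c => // n IH c lc Dc wb.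
have [->|/eqP ne] := eqVneq c z'; first exact: reach_root.
have [Dp wp] := strictly_below_par Dc wb ne.
apply: reach_of_par => //; apply: IH => //.
case: wp => t lt /(onpath_ge z1 z2 ry) /= [g1 g2].
have := @rank_par G' z z1 z2 c; lia.
Qed.

(** A step to the left could get below the path only where the path descends from [(h.-1, m.-1)] to
    [(h, m.-1)]. There the left neighbour carries the label of [(h.-1, m.-1)], which is smaller than
    the label above, so the step goes up. *)
Lemma not_strictly_below_par c : D c -> c.1 <= y.1 -> ~ strictly_below c ->
  z.2 <= (par' c).2 -> ~ strictly_below (par' c).
Proof.
case: c => h m Dc /= ly nb; case: (par_cases G' (h, m)) => e; rewrite e /= => lm.
  case=> t /= lt p; have [/= t1 t2] := onpath_ge z1 z2 ry p.
  have hz : z.1 <= h.-1 by lia.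
  have hy : h.-1 < y.1 by lia.
  have pr := onpath_rcol z1 z2 ry hz (ltnW hy).
  have pb := onpath_below_rcol z1 z2 ry hz hy.
  have lth : t <= h.-1 by lia.
  have le := rcol_bound z1 z2 ry hz (ltnW hy) lth p.
  have eh : h.-1.+1 = h by lia.
  have [_ m0] := wd_gt0 Dc; rewrite /= in m0.
  case: (leqP m (rc y h.-1)) => lr.
    have [|t' lt' p'] := onpath_col z1 z2 ry pr _ lr; first lia.
    by apply: nb; exists t' => //=; lia.
  have er : rc y h.-1 = m.-1 by lia.
  rewrite er eh in pr pb.
  have nz : (h, m.-1) <> z by move=> ez; move: t1; rewrite -ez /=; lia.
  have ep : par (h, m.-1) = (h.-1, m.-1).
    have := onpath_par z1 z2 ry pb nz.
    case: (par_cases G (h, m.-1)) => -> // pp.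
    have [_ /= ?] := onpath_ge z1 z2 ry pp.
    have := onpath_chain z1 z2 ry pp pr; rewrite /=; lia.
  have Gl : G' (lft (h, m)) = G (h.-1, m.-1).
    by rewrite /lft /shifted /=; case: eqVneq => // _; rewrite pb ep.
  have Ga : G' (abv (h, m)) = G (h.-1, m).
    rewrite /abv /shifted /=; case: eqVneq => ez.
      by move: t2; rewrite -ez /=; lia.
    by case: ifP => // pa; case: nb; exists h.-1 => //=; lia.
  have := par_lft _ e; rewrite Gl Ga /= => l1.
  have : G (h.-1, m.-1) < G (rgt (h.-1, m.-1)).
    apply: G_rgt; first exact: Gpath.
    rewrite /rgt /=; apply: (Dge Dc) => /=; lia.
  by rewrite /rgt /= prednK //; lia.
by case=> t /= lt p; apply: nb; exists t => //=; lia.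
Qed.

Lemma not_strictly_below_reach c : D c -> c.1 <= y.1 -> ~ strictly_below c ->
  ~ reach' c.
Proof.
have [n] := ubnP (rank c); elim: n c => // n IH c lc Dc ly nb r.
have [e|/eqP ne] := eqVneq c z'.
  by apply: nb; rewrite e; exists z.1 => //=; rewrite -surjective_pairing onpath_root.
have rp := reach_par z1' z2' r ne.
have [/= g1 g2] := reach_ge rp.
have [l1 l2] := iter_par_le G' 1 c; rewrite /= in l1 l2.
apply: (IH (par' c)) => //.
- by have := rank_par z1' z2' g1 g2; lia.
- by case: (par' c) g1 g2 l1 l2 => a b /= *; apply: (Dge Dc) => //; lia.
- exact: leq_trans ly.
- exact: not_strictly_below_par.
Qed.

Lemma rcol_onpath w c g : reach w -> P w c -> z.1 <= g -> g < c.1 ->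
  rc w g = rc c g.
Proof.
move=> rw p lz lc; have rcc := onpath_reach z1 z2 rw p.
have [lw _] := onpath_end z1 z2 rw p.
have key m : P w (g, m) -> P c (g, m).
  move=> pm; rewrite (onpath_sub z1 z2 rw p) //.
  by case: (onpath_chain z1 z2 rw p pm); rewrite /rank /=; lia.
symmetry; apply: rcol_unique => //; first exact: ltnW.
  by apply: key; apply: onpath_rcol => //; lia.
move=> m pm; apply: rcol_max => //; rewrite -(onpath_sub z1 z2 rw p) //.
by case/and3P: pm.
Qed.

(** In columns up to [y.2] the cell [w] is below the path of [y], and both sides hold. Further right
    the neighbouring labels are unchanged, so [w] takes the same step for both labellings until it
    enters row [y.1] or one of those columns. *)
Lemma shifted_reach_low w : D w -> y.1 < w.1 ->
  reach' w = reach w && (rc w y.1 <= y.2).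
Proof.
have [zy1 zy2] := reach_ge ry.
have [n] := ubnP (rank w); elim: n w => // n IH w lw Dw hw.
case: (ltnP w.2 z.2) => lz.
  by rewrite /reaches /= [z.2 <= _]leqNgt lz /= !andbF.
case: (leqP w.2 y.2) => lm.
  have py : P y (y.1, y.2) by rewrite -surjective_pairing onpath_refl.
  have [t lt p] := onpath_col z1 z2 ry py lz lm.
  have sb : strictly_below w by exists t => //; lia.
  have wb : weakly_below G z y w by exists t => //; lia.
  rewrite strictly_below_reach //.
  have rw := weakly_below_reach wd_gt0 wd_down Dz G_supp ry Dw wb.
  rewrite rw /=; have pr := onpath_rcol z1 z2 rw zy1 (ltnW hw).
  by have [_ /= l2] := onpath_end z1 z2 rw pr; rewrite (leq_trans l2 lm).
have nz : w <> z by move=> e; move: hw; rewrite e; lia.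
have nz' : w <> z' by move=> e; move: lm; rewrite e /=; lia.
have Ga : G' (abv w) = G (abv w).
  rewrite /shifted; case: eqVneq => [e|_].
    by move: lm; rewrite -[w.2]/((abv w).2) e; lia.
  by case: ifP => // /(onpath_end z1 z2 ry) /=; lia.
have Gl : G' (lft w) = G (lft w).
  rewrite /shifted; case: eqVneq => [e|_].
    by move: hw; rewrite -[w.1]/((lft w).1) e; lia.
  by case: ifP => // /(onpath_end z1 z2 ry) /=; lia.
have ep : par' w = par w by rewrite /parent Ga Gl.
have e' : reach' w = reach' (par w).
  apply/idP/idP; last by rewrite -ep; apply: reach_of_par.
  by rewrite -ep => /reach_par; apply.
have er : reach w = reach (par w).
  by apply/idP/idP; [move/reach_par; apply | apply: reach_of_par].
have [l1 l2] := iter_par_le G 1 w; rewrite /= in l1 l2.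
have Dpar : z.1 <= (par w).1 -> z.2 <= (par w).2 -> D (par w).
  by case: (par w) l1 l2 => a b /= *; apply: (Dge Dw).
case: (leqP z.1 (par w).1) => g1; last first.
  rewrite e' er /reaches [z.1 <= _]leqNgt g1 /=.
  by rewrite [_.1 < (par w).1]ltnNge (ltnW g1).
case: (leqP z.2 (par w).2) => g2; last first.
  by rewrite e' er /reaches /= [z.2 <= _]leqNgt g2 !andbF.
have rk := rank_par z1 z2 g1 g2.
(* If the step enters row [y.1], it does so in column [w.2 > y.2], which is not strictly below the
   path, and both sides fail. Otherwise the induction hypothesis applies to [par w]. *)
case: (leqP (par w).1 y.1) => lr.
  have epw : par w = (y.1, w.2).
    by move: lr g1; case: (par_cases G w) => ->; rewrite /lft /abv /=;
      [lia|move=> *; congr pair; lia].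
  have -> : reach' w = false.
    apply/negP; rewrite e'; apply: not_strictly_below_reach => //; first exact: Dpar.
    by case=> t _; rewrite epw /= => /(onpath_end z1 z2 ry) /=; lia.
  symmetry; apply/negP => /andP[rw]; apply/negP; rewrite -ltnNge.
  apply: (leq_trans lm); apply: rcol_max => //.
  by rewrite -epw; apply: onpath_par => //; apply: onpath_refl.
rewrite e' er IH //; [|lia|exact: Dpar].
case rp: (reach (par w)) => //=.
rewrite [in RHS](@rcol_onpath _ (par w)) ?er //.
by apply: onpath_par; rewrite ?er //; apply: onpath_refl; rewrite ?er.
Qed.

(** The number [a_h] for the labels [K] and the root [o]. *)
Definition row_count (K : cell -> nat) (o : cell) (h : nat) : nat :=
  count (fun m => reaches K o (h, m)) (iota 1 (wd h)).

Lemma shifted_row_count_low h : y.1 < h -> row_count G' z' h =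
  count (fun m => reach (h, m) && lt (h, m) y) (iota 1 (wd h)).
Proof.
move=> lh; apply: eq_in_count => m; rewrite mem_iota => lm.
rewrite shifted_reach_low //=; last by rewrite D_wd; lia.
by rewrite /path_lt /= lh.
Qed.

(** Let the path of [y] leave row [h.-1] in column [e]. The cells of row [h] strictly below the path
    fill the columns [z.2] to [e], while the cells of row [h.-1] that precede [y] fill the columns
    [z.2] to [e - 1]: one fewer. *)
Lemma shifted_row_count_high h : z.1 < h -> h <= y.1 -> row_count G' z' h =
  (count (fun m => reach (h.-1, m) && lt (h.-1, m) y) (iota 1 (wd h.-1))).+1.
Proof.
move=> lz ly; pose e := rc y h.-1.
have hz : z.1 <= h.-1 by lia.
have hy : h.-1 < y.1 by lia.
have eh : h.-1.+1 = h by lia.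
have pr := onpath_rcol z1 z2 ry hz (ltnW hy).
have pb := onpath_below_rcol z1 z2 ry hz hy; rewrite eh in pb.
have [_ /= ze] := onpath_ge z1 z2 ry pr.
have := DP pb; rewrite D_wd => /and3P[h0 e0 ew].
have ww : wd h <= wd h.-1 by rewrite -{1}eh; apply: wd_anti; lia.
transitivity (e.+1 - z.2).
  rewrite -(@count_iota_range _ _ (wd h)) //.
  apply: eq_in_count => m; rewrite mem_iota => lm.
  have Dm : D (h, m) by rewrite D_wd; lia.
  apply/idP/idP => [r|/andP[l1 l2]].
    have [_ /= g] := reach_ge r; rewrite g /=.
    rewrite ltnS leqNgt; apply/negP => lt; move: r.
    apply/negP; apply/negP => r; apply: (not_strictly_below_reach Dm ly _ r).
    case=> t /= lt' p; have lth : t <= h.-1 by lia.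
    by have := rcol_bound z1 z2 ry hz (ltnW hy) lth p; rewrite -/e; lia.
  apply: strictly_below_reach => //.
  have [|t lt p] := onpath_col z1 z2 ry pr l1; first by rewrite -/e; lia.
  by exists t => //=; lia.
rewrite subSn //; congr S.
rewrite -(@count_iota_range _ _ (wd h.-1)) //; last by rewrite /e; lia.
apply: eq_in_count => m; rewrite mem_iota => lm.
have -> : lt (h.-1, m) y = (m < e) by rewrite /path_lt /= ltnNge (ltnW hy).
case: (ltnP m e) => [lme|]; last by rewrite !andbF.
rewrite !andbT; apply/idP/idP => [l1|r]; last by have [] := reach_ge r.
apply: (weakly_below_reach wd_gt0 wd_down Dz G_supp ry).
  by rewrite D_wd; lia.
by apply: (row_weakly_below wd_gt0 Dz ry l1 _ pr); apply: ltnW.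
Qed.

End Shift.

(** * Summing the weights along the traversal *)

Lemma prod_nat_step (i r x : nat) (F F' : nat -> nat) : i <= x -> x < r ->
  (forall h, h != x -> F' h = F h) -> F' x = (F x).+1 ->
  \prod_(i <= h < r) F' h =
  \prod_(i <= h < r) F h + \prod_(i <= h < r | h != x) F h.
Proof.
move=> lx xr e ex; have xin : x \in index_iota i r by rewrite mem_index_iota lx.
rewrite (bigD1_seq x) ?iota_uniq //= [X in _ = X + _](bigD1_seq x) ?iota_uniq //=.
by rewrite ex mulSn addnC; congr (_ * _ + _); apply: eq_bigr => h /e.
Qed.

(** Induction from the end of [s]: the last cell [x] raises the factor of its own row by one, so the
    full product grows by the product over the other rows, and that is the summand of [x]. *)
Lemma sum_prod_telescope (lt : rel cell) (s : seq cell) (i r : nat)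
    (f : nat -> nat) :
  {in s, forall c, i <= c.1 < r} -> {in s &, forall w y, lt w y -> ~~ lt y w} ->
  pairwise lt s ->
  \sum_(y <- s) \prod_(i <= h < r | h != y.1)
      (f h + count (fun w => (w.1 == h) && lt w y) s) + \prod_(i <= h < r) f h =
  \prod_(i <= h < r) (f h + count (fun w => w.1 == h) s).
Proof.
elim/last_ind: s => [|s x IH] rows asym.
  by move=> _; rewrite big_nil add0n; apply: eq_bigr => h _; rewrite addn0.
rewrite pairwise_rcons => /andP[/allP ltx pw].
have sub : {subset s <= rcons s x} by move=> c; rewrite mem_rcons inE orbC => ->.
have xin : x \in rcons s x by rewrite mem_rcons inE eqxx.
have irr c : c \in rcons s x -> ~~ lt c c.
  by move=> cs; apply/negP => l; have := asym _ _ cs cs l; rewrite l.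
have cntx y h : y \in rcons s x -> ~~ lt x y ->
    count (fun w => (w.1 == h) && lt w y) (rcons s x) =
    count (fun w => (w.1 == h) && lt w y) s.
  by move=> _ /negbTE nl; rewrite -cats1 count_cat /= nl andbF !addn0.
rewrite -cats1 big_cat big_seq1 /= cats1 addnAC.
have -> : \sum_(y <- s) \prod_(i <= h < r | h != y.1)
      (f h + count (fun w => (w.1 == h) && lt w y) (rcons s x)) =
    \sum_(y <- s) \prod_(i <= h < r | h != y.1)
      (f h + count (fun w => (w.1 == h) && lt w y) s).
  apply: eq_big_seq => y ys; apply: eq_bigr => h _; rewrite cntx ?sub //.
  exact: asym (sub _ ys) xin (ltx _ ys).
rewrite {}IH //; last 2 first.
- by move=> c cs; apply: rows; apply: sub.
- by move=> w y ws ys; apply: asym; apply: sub.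
have /andP[ix xr] := rows _ xin.
have cx h : count (fun w => (w.1 == h) && lt w x) (rcons s x) =
            count (fun w => w.1 == h) s.
  rewrite cntx ?irr //; apply: eq_in_count => w ws.
  by rewrite ltx // andbT.
under [X in _ + X = _]eq_bigr => h _ do rewrite cx.
symmetry; apply: prod_nat_step => //.
  by move=> h ne; rewrite -cats1 count_cat /= eq_sym (negbTE ne) !addn0.
by rewrite -cats1 count_cat /= eqxx !addn0 addn1 addnS.
Qed.

(** The rows after [i] correspond to the rows from [i] on without [x], shifted by one up to [x];
    this brings the weights of the preimages into the form that telescopes. *)
Lemma prod_nat_skip (F F' : nat -> nat) (i x r : nat) : i <= x -> x < r ->
  (forall h, i < h -> h <= x -> F h = F' h.-1) ->
  (forall h, x < h -> h < r -> F h = F' h) ->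
  \prod_(i.+1 <= h < r) F h = \prod_(i <= h < r | h != x) F' h.
Proof.
move=> ix xr lo hi.
rewrite (@big_cat_nat _ _ _ x.+1) //=.
rewrite [RHS](@big_cat_nat _ _ _ x) //=; last exact: ltnW.
congr (_ * _).
  rewrite big_add1 /= big_nat [RHS]big_nat_cond.
  apply: eq_big => [h|h /andP[ih hx]]; first by case: ltngtP; lia.
  by rewrite lo //=; lia.
rewrite [RHS]big_mkcond [RHS]big_ltn // eqxx /= mul1n.
rewrite big_nat [RHS]big_nat; apply: eq_bigr => h /andP[xh hr].
by rewrite hi //; case: eqVneq => // e; rewrite e ltnn in xh.
Qed.

Section Weight.
Variables (D : pred cell) (wd : nat -> nat) (G : cell -> nat) (z : cell).
Hypothesis D_wd : forall h m, D (h, m) = [&& 0 < h, 0 < m & m <= wd h].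
Hypothesis wd_anti : forall h, 0 < h -> wd h.+1 <= wd h.
Hypothesis Dz : D z.
Hypothesis G_supp : forall c, (0 < G c) = D c && col_le z c.
Hypothesis G_rgt : forall c, 0 < G c -> D (rgt c) -> G c < G (rgt c).
Hypothesis G_blw : forall c, 0 < G c -> D (blw c) -> G c < G (blw c).
Variables (cs : seq cell) (r : nat).
Hypotheses (cs_uniq : uniq cs) (mem_cs : cs =i D).
Hypothesis D_col : forall h, D (h, z.2) -> h <= r.

Lemma count_row h (Q : pred cell) : 0 < h ->
  count (fun c => (c.1 == h) && Q c) cs = count (fun m => Q (h, m)) (iota 1 (wd h)).
Proof.
move=> h0; rewrite -[RHS](count_map (pair h)) -!size_filter.
apply: perm_size; apply: uniq_perm.
- exact: filter_uniq.
- by rewrite filter_uniq // map_inj_uniq ?iota_uniq // => a b [].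
move=> [a b]; rewrite !mem_filter mem_cs /= -andbA andbCA; congr (_ && _).
rewrite -[_ \in D]/(D (a, b)) D_wd.
apply/andP/mapP => [[/eqP-> /and3P[_ b0 bw]]|[m mi [-> ->]]].
  by exists b => //; rewrite mem_iota; lia.
by move: mi; rewrite mem_iota => ?; split=> //; lia.
Qed.

(** The cells that reach [z] index the preimages of a slide. Listed in traversal order, their
    weights are the summands of [sum_prod_telescope]. *)
Lemma sum_weight_shifted :
  \sum_(y <- cs | reaches G z y) \prod_(z.1.+1 <= h < r.+1)
     (r - h + row_count wd (shifted G z y) (blw z) h) =
  \prod_(z.1 <= h < r.+1) (r - h + row_count wd G z h).
Proof.
have [z1 z2] := wd_gt0 D_wd Dz.
pose R := [seq c <- cs | reaches G z c].
have inR c : c \in R = reaches G z c && D c by rewrite mem_filter mem_cs.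
(* Sorting asks for a total relation, hence the reflexive closure; strictness is recovered from the
   absence of repetitions. *)
pose le w y := (w == y) || path_lt G z w y.
pose s := sort le R.
have ps : perm_eq s R by apply/permPl; apply: perm_sort.
have ins c : c \in s = reaches G z c && D c by rewrite (perm_mem ps).
have rows : {in s, forall c, z.1 <= c.1 < r.+1}.
  move=> [a b]; rewrite ins => /andP[/reach_ge[/= g1 g2] Dc].
  rewrite g1 /= ltnS; apply: D_col; apply: (wd_down D_wd wd_anti Dc) => /=; lia.
have asym : {in s &, forall w y, path_lt G z w y -> ~~ path_lt G z y w}.
  move=> w y; rewrite !ins => /andP[rw _] /andP[ry _].
  exact: (path_lt_asym (wd_gt0 D_wd) Dz).
have pw : pairwise (path_lt G z) s.
  have le_tr : {in R & &, transitive le}.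
    move=> b a c; rewrite !inR => /andP[rb Db] /andP[ra Da] /andP[rc Dc].
    rewrite /le => /orP[/eqP->//|ab] /orP[/eqP<-|bc]; first by rewrite ab orbT.
    by rewrite (path_lt_trans (wd_gt0 D_wd) (wd_down D_wd wd_anti) Dz G_supp
       ra rb rc Da Db Dc ab bc) orbT.
  have le_tot : {in R &, total le}.
    move=> a b; rewrite !inR => /andP[ra Da] /andP[rb Db]; rewrite /le.
    have [//|ne] := eqVneq a b.
    by have := path_lt_total (wd_gt0 D_wd) Dz ra rb ne; case/orP=> ->; rewrite ?orbT.
  have srt : sorted le s by apply: (sort_sorted_in le_tot); apply/allP.
  have le_trs : {in s & &, transitive le}.
    by move=> b a c; rewrite !(perm_mem ps); apply: le_tr.
  move: srt; rewrite (sorted_pairwise_in le_trs) ?allss // => pwl.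
  have us : uniq s by rewrite sort_uniq filter_uniq.
  have : pairwise [rel w y | (w != y) && le w y] s.
    by rewrite pairwise_relI -uniq_pairwise us.
  by apply: sub_pairwise => a b /= /andP[/negbTE ne]; rewrite /le ne.
rewrite -big_filter -/R -(perm_big _ ps) /=.
have zr : z.1 <= r by apply: D_col; rewrite -surjective_pairing.
have cnt (Q : pred cell) h : 0 < h ->
    count (fun w => (w.1 == h) && Q w) s =
    count (fun m => reaches G z (h, m) && Q (h, m)) (iota 1 (wd h)).
  move=> h0; rewrite (permP ps) count_filter.
  rewrite -[RHS](count_row (fun w => reaches G z w && Q w) h0).
  by apply: eq_count => w /=; rewrite -andbA; congr (_ && _); rewrite andbC.
have := sum_prod_telescope (fun h => r - h) rows asym pw.
(* The initial product of the telescope vanishes: its factor for the bottom row is [r - r]. *)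
rewrite [X in _ + X = _]big_nat_recr //= subnn muln0 addn0 => e.
transitivity (\prod_(z.1 <= h < r.+1) (r - h + count (fun w => w.1 == h) s)).
  rewrite -{}e; apply: eq_big_seq => y; rewrite ins => /andP[ry Dy].
  have ys : y \in s by rewrite ins ry.
  have /andP[zy yr] := rows _ ys.
  apply: prod_nat_skip => // h l1 l2.
    rewrite (shifted_row_count_high D_wd wd_anti Dz G_supp G_rgt G_blw ry Dy) //.
    rewrite (cnt (fun w => path_lt G z w y)) /=; last lia.
    have hr : h <= r := leq_trans l2 yr.
    (* The extra one in the shifted count turns [r - h] into [r - h.-1]. *)
    by rewrite addnS -addSn; congr (_ + _); lia.
  rewrite (shifted_row_count_low D_wd wd_anti Dz G_supp G_rgt G_blw ry Dy) //.
  by rewrite (cnt (fun w => path_lt G z w y)) //=; lia.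
rewrite big_nat [RHS]big_nat; apply: eq_bigr => h /andP[l1 l2]; congr (_ + _).
rewrite (@eq_count _ _ (fun w => (w.1 == h) && xpredT w)); last first.
  by move=> w; rewrite andbT.
rewrite cnt; last by lia.
by apply: eq_count => m; rewrite andbT.
Qed.

End Weight.

(** * Undoing a slide *)

Definition adj (c d : cell) : bool := (d == rgt c) || (d == blw c).

Definition region (lam : seq nat) (z c : cell) : bool :=
  in_diag lam c && col_le z c.

Definition sorted_from (lam : seq nat) (z : cell) (U : filling) : Prop :=
  forall c d, region lam z c -> in_diag lam d -> adj c d -> U c < U d.

Definition inj_diag (lam : seq nat) (U : filling) : Prop :=
  {in in_diag lam &, injective U}.

(** The successor keeps every sorted cell, whatever its entry, apart from the label 0 of the other
    cells. *)
Definition restr (lam : seq nat) (z : cell) (U : filling) (c : cell) : nat :=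
  if region lam z c then (U c).+1 else 0.

(* The filling from which the slide moves the entry [V y] from [p] to [y],
   where [p] lies on the reverse path of [y] in [V]. *)
Definition rollback (lam : seq nat) (z : cell) (V : filling) (y p : cell)
  : filling :=
  fun c => if c == p then V y
           else if (rank p < rank c) && on_path (restr lam z V) z y c
                then V (parent (restr lam z V) c) else V c.

Lemma adj_rank c d : adj c d -> rank d = (rank c).+1.
Proof. by rewrite /adj /rank => /orP[]/eqP->; rewrite /=; lia. Qed.

Lemma adj_neq c d : adj c d -> (d == c) = false.
Proof. by move=> a; apply/eqP => e; move: (adj_rank a); rewrite e; lia. Qed.

Lemma adj_neq2 c e d : adj c e -> adj e d -> (d == c) = false.
Proof.
move=> a b; apply/eqP => h; move: (adj_rank a) (adj_rank b); rewrite h; lia.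
Qed.

Lemma swapfK U p q : swapf (swapf U p q) p q = U.
Proof.
apply: functional_extensionality => c; rewrite /swapf eqxx.
have [->|np] := eqVneq c p; first by case: eqVneq => [->|_] //; rewrite ?eqxx.
by case: (eqVneq c q) => [->|_] //; rewrite eqxx.
Qed.

Lemma swapfC U p q : swapf U p q = swapf U q p.
Proof.
apply: functional_extensionality => c; rewrite /swapf.
have [->|np] := eqVneq c p; first by have [->|nq] := eqVneq p q; rewrite ?eqxx.
by have [_|nq] := eqVneq c q; rewrite ?(negbTE np).
Qed.

Section Diagram.
Variable lam : seq nat.
Local Notation D := (in_diag lam).

Lemma slide_step_Some U p U' q : slide_step lam U p = Some (U', q) ->
  [/\ adj p q, D q, U' = swapf U p q, U q < U p &
      forall d, D d -> adj p d -> U q <= U d].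
Proof.
rewrite /slide_step -/(rgt p) -/(blw p).
case Dr: (D (rgt p)); case Db: (D (blw p)) => //.
- case: (ltnP (U (rgt p)) (U (blw p))) => lt; case: ifP => // lt2 [<- <-].
    split=> //; first by rewrite /adj eqxx.
    by move=> d _ /orP[]/eqP->; rewrite // ltnW.
  split=> //; first by rewrite /adj eqxx orbT.
  by move=> d _ /orP[]/eqP->.
- case: ifP => // lt [<- <-]; split=> //; first by rewrite /adj eqxx.
  by move=> d Dd /orP[]/eqP e; rewrite e // in Dd *; rewrite Db in Dd.
- case: ifP => // lt [<- <-]; split=> //; first by rewrite /adj eqxx orbT.
  by move=> d Dd /orP[]/eqP e; rewrite e // in Dd *; rewrite Dr in Dd.
Qed.

Lemma slide_step_None U p : slide_step lam U p = None ->
  forall d, D d -> adj p d -> U p <= U d.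
Proof.
rewrite /slide_step -/(rgt p) -/(blw p).
case Dr: (D (rgt p)); case Db: (D (blw p)) => //.
- case: (ltnP (U (rgt p)) (U (blw p))) => lt; case: ifP => // /negbT;
    rewrite -leqNgt => lt2 _ d _ /orP[]/eqP-> //; lia.
- case: ifP => // /negbT; rewrite -leqNgt => lt _ d Dd.
  by move=> /orP[]/eqP e; rewrite e // in Dd *; rewrite Db in Dd.
- case: ifP => // /negbT; rewrite -leqNgt => lt _ d Dd.
  by move=> /orP[]/eqP e; rewrite e // in Dd *; rewrite Dr in Dd.
- by move=> _ d Dd /orP[]/eqP e; move: Dd; rewrite e ?Dr ?Db.
Qed.

Lemma slide_step_to U p q : adj p q -> D q -> U q < U p ->
  (forall d, D d -> adj p d -> d != q -> U q < U d) ->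
  slide_step lam U p = Some (swapf U p q, q).
Proof.
move=> apq Dq lt h; case e: (slide_step lam U p) => [[U' q']|]; last first.
  by have := slide_step_None e Dq apq; lia.
have [a' D' -> _ /(_ _ Dq apq) le] := slide_step_Some e.
suff -> : q' = q by [].
by apply/eqP; apply/negPn/negP => ne; have := h _ D' a' ne; lia.
Qed.

Lemma slide_step_stop U p : (forall d, D d -> adj p d -> U p <= U d) ->
  slide_step lam U p = None.
Proof.
move=> h; case e: (slide_step lam U p) => [[U' q']|] //.
by have [a' D' _ lt _] := slide_step_Some e; have := h _ D' a'; lia.
Qed.

Lemma slide_aux_stop f U p : (forall d, D d -> adj p d -> U p <= U d) ->
  slide_aux lam f U p = U.
Proof. by case: f => //= f /slide_step_stop ->. Qed.

Lemma inj_swapf U p q : D p -> D q -> inj_diag lam U -> inj_diag lam (swapf U p q).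
Proof.
move=> Dp Dq inj c d Dc Dd; rewrite /swapf.
have [->|cp] := eqVneq c p; have [->|dp] := eqVneq d p => //.
- by have [->|dq] := eqVneq d q => /inj e; [rewrite e|move: dq; rewrite e ?eqxx].
- by have [->|dq] := eqVneq c q => /inj e; [rewrite -e|move: dq; rewrite e ?eqxx].
- have [->|cq] := eqVneq c q; have [->|dq] := eqVneq d q => // /inj e.
  + by move: dp; rewrite e ?eqxx.
  + by move: cp; rewrite e ?eqxx.
  + exact: e.
Qed.

Hypothesis lam_sorted : sorted geq lam.

Lemma diag_wd h m : D (h, m) = [&& 0 < h, 0 < m & m <= part lam h].
Proof. by []. Qed.

Lemma part_anti h : 0 < h -> part lam h.+1 <= part lam h.
Proof.
case: h => // h _; rewrite /part /=.
case: (ltnP h.+1 (size lam)) => l; last by rewrite nth_default.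
by have /(sortedP 0)/(_ h l) := lam_sorted.
Qed.

(** The diagram contains the rectangle with corners [(1, 1)] and [(h, m)]. *)
Lemma sumn_ge_mul h m : D (h, m) -> h * m <= sumn lam.
Proof.
elim: lam lam_sorted h => [|a l IH] srt h.
  by rewrite /in_diag /part nth_nil; lia.
rewrite /= in srt; case: h => [|[|h]]; rewrite /in_diag //= /part /=.
  by lia.
move=> lm; have sl : sorted geq l by apply: path_sorted srt.
have Dl : in_diag l (h.+1, m) by rewrite /in_diag /part /=; lia.
have := IH sl _ Dl.
suff : m <= a by lia.
have : nth 0 l h \in l.
  apply: mem_nth; case: (ltnP h (size l)) => // ?.
  by move: lm; rewrite nth_default //; lia.
have tr : transitive geq by move=> x y w; rewrite /geq /=; lia.
have /allP h_all := order_path_min tr srt.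
by move/h_all; rewrite /=; lia.
Qed.

(** For positive [h] and [m], [h + m - 1 <= h * m]. This bound shows that the fuel of [slide]
    suffices. *)
Lemma diag_rank c : D c -> rank c <= (sumn lam).+1.
Proof.
case: c => h m Dc; have := sumn_ge_mul Dc.
by move: Dc; rewrite /in_diag /rank /= => /and3P[h0 m0 _]; nia.
Qed.

Section Slide.
Variable z : cell.
Hypothesis Dz : D z.
Local Notation R := (region lam z).

Let z1 : 0 < z.1. Proof. by case: (wd_gt0 diag_wd Dz). Qed.
Let z2 : 0 < z.2. Proof. by case: (wd_gt0 diag_wd Dz). Qed.

Lemma region_adj c d : R c -> D d -> adj c d -> R d.
Proof.
rewrite /region /adj /col_le => /andP[_ h] -> /=.
by case/orP=> /eqP-> /=; lia.
Qed.

(** The invariant of a slide whose moving entry is in [p]: the order may fail only between [p] and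
    its successors. The last clause keeps the order across [p], which is needed when the entry of a
    successor moves into [p]. *)
Definition sorted_but (W : filling) (p : cell) : Prop :=
  [/\ R p, forall c d, R c -> D d -> adj c d -> c != p -> W c < W d &
      forall c d, R c -> D d -> adj c p -> adj p d -> W c < W d].

Lemma sorted_but_step W p q : sorted_but W p -> adj p q -> D q -> W q < W p ->
  (forall d, D d -> adj p d -> d != q -> W q < W d) ->
  sorted_but (swapf W p q) q.
Proof.
move=> [Rp S1 S2] apq Dq lt min; have Rq := region_adj Rp Dq apq.
have npq : q != p by rewrite (adj_neq apq).
split=> // c d Rc Dd.
  move=> acd ncq; rewrite /swapf; have [ecp|ncp] := eqVneq c p.
    have [edp|ndp] := eqVneq d p.
      by have := adj_neq acd; rewrite ecp edp eqxx.
    have [//|ndq] := eqVneq d q.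
    by apply: min; rewrite -?ecp.
  rewrite (negbTE ncq); have [edp|ndp] := eqVneq d p.
    by apply: S2 => //; rewrite -edp.
  have [edq|ndq] := eqVneq d q; last exact: S1.
  by apply: leq_trans lt; rewrite -edq ltnS; apply/ltnW/S1.
move=> acq aqd; rewrite /swapf.
rewrite (adj_neq2 apq aqd) (adj_neq aqd).
have [_|ncp] := eqVneq c p; first exact: S1.
rewrite eq_sym (adj_neq acq).
by apply: (@ltn_trans (W q)); apply: S1.
Qed.

Lemma sorted_but_sorted W p : inj_diag lam W -> sorted_but W p ->
  (forall d, D d -> adj p d -> W p <= W d) -> sorted_from lam z W.
Proof.
move=> inj [Rp S1 _] h c d Rc Dd acd; have [e|ne] := eqVneq c p; last exact: S1.
rewrite ltn_neqAle e h -?e // andbT; apply/eqP => /inj ed.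
by have := adj_neq acd; rewrite ed ?eqxx //; case/andP: Rc.
Qed.

Lemma sorted_from_blw W : sorted_from lam (blw z) W -> sorted_but W z.
Proof.
move=> S; split.
- by rewrite /region Dz /col_le eqxx leqnn orbT.
- move=> c d /andP[Dc lc] Dd acd ne; apply: S => //.
  by rewrite /region Dc col_le_blw lc ne.
- move=> c d /andP[_]; rewrite /col_le => lc _ /orP[]/eqP e;
    by move: lc; rewrite e /=; lia.
Qed.

Lemma restr_supp V c : (0 < restr lam z V c) = D c && col_le z c.
Proof. by rewrite /restr /region; case: ifP. Qed.

Lemma restr_adj V c d : sorted_from lam z V -> 0 < restr lam z V c -> D d ->
  adj c d -> restr lam z V c < restr lam z V d.
Proof.
rewrite restr_supp => S Rc Dd acd.
by rewrite /restr (region_adj Rc Dd acd) {1}/region Rc ltnS; apply: S.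
Qed.

Section Rollback.
Variables (V : filling) (y : cell).
Local Notation G := (restr lam z V).
Local Notation P := (on_path G z y).
Lemma rollback_end : rollback lam z V y y = V.
Proof.
apply: functional_extensionality => c; rewrite /rollback.
case: eqVneq => [->//|_]; case: ifP => // /andP[lt /and3P[_ le _]]; lia.
Qed.

Lemma onpath_rank_inj c d : P c -> P d -> rank c = rank d -> c = d.
Proof. by move=> /and3P[_ _ /eqP ec] /and3P[_ _ /eqP ed] e; rewrite -ec -ed e. Qed.

Lemma rollback_parent d : P d -> rank d = (rank (parent G d)).+1 ->
  rollback lam z V y (parent G d) = swapf (rollback lam z V y d) d (parent G d).
Proof.
move=> pd er.
apply: functional_extensionality => c; rewrite /swapf /rollback eqxx.
have nd : parent G d != d by apply/eqP => e; rewrite {1}e in er; lia.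
have [->|ncd] := eqVneq c d.
  rewrite eq_sym (negbTE nd) pd er ltnSn /=.
  by case: ifP => // /andP[]; lia.
case: eqVneq => // ncp; congr (if _ then _ else _).
case pc: (P c); rewrite ?andbF // !andbT.
have : rank c <> rank d by move=> /(onpath_rank_inj pc pd) e; rewrite e eqxx in ncd.
lia.
Qed.

Hypotheses (ry : reaches G z y) (Dy : D y).

Lemma onpath_region c : P c -> R c.
Proof.
move=> p; rewrite /region.
rewrite (onpath_D (wd_gt0 diag_wd) (wd_down diag_wd part_anti) Dz ry Dy p) /=.
by have [? ?] := onpath_ge z1 z2 ry p; rewrite /col_le; lia.
Qed.

Lemma parent_rank c : P c -> c <> z -> rank c = (rank (parent G c)).+1.
Proof.
move=> p ne; have [g1 g2] := onpath_ge z1 z2 ry (onpath_par z1 z2 ry p ne).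
exact: (rank_par z1 z2).
Qed.

Lemma onpath_rank_gt c : P c -> c <> z -> rank z < rank c.
Proof.
move=> pc ne; rewrite (parent_rank pc ne) ltnS.
by case/and3P: (onpath_par z1 z2 ry pc ne).
Qed.

Lemma parent_adj c : P c -> c <> z -> adj (parent G c) c.
Proof.
move=> p ne; have [g1 g2] := onpath_ge z1 z2 ry (onpath_par z1 z2 ry p ne).
move: g1 g2; rewrite /adj; case: c {p ne} => a b.
by case: (par_cases G (a, b)) => ->; rewrite /lft /abv /rgt /blw /= => g1 g2;
  [rewrite prednK ?eqxx //|rewrite prednK ?eqxx ?orbT //]; lia.
Qed.

Hypothesis SV : sorted_from lam z V.

Lemma onpath_lt_end c : P c -> c <> y -> V c < V y.
Proof.
case/(onpathP z1 z2 ry) => k lk ->.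
have Py := onpath_refl z1 z2 ry.
elim: k lk => [|k IH] lk //= ne.
have pk : P (iter k (parent G) y) by apply/(onpathP z1 z2 ry); exists k => //; lia.
have nz : iter k (parent G) y <> z.
  by move=> e; have [_] := reach_iter z1 z2 ry (ltnW lk); rewrite e; lia.
have lt : V (parent G (iter k (parent G) y)) < V (iter k (parent G) y).
  apply: SV; last exact: parent_adj.
    exact/onpath_region/onpath_par.
  by case/andP: (onpath_region pk).
have [e|/eqP ny] := eqVneq (iter k (parent G) y) y; first by rewrite e in lt *.
exact: ltn_trans lt (IH (ltnW lk) ny).
Qed.

(** The moving entry [V y] exceeds all other entries on the path, so it moves on. It chooses [d],
    which holds [V (parent G d)], because any other successor of [parent G d] has a larger entry in
    the sorted [V]. *)
Lemma rollback_step d : P d -> d <> z ->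
  slide_step lam (rollback lam z V y (parent G d)) (parent G d) =
  Some (rollback lam z V y d, d).
Proof.
move=> pd ne; have er := parent_rank pd ne; have pp := onpath_par z1 z2 ry pd ne.
have Dd : D d by case/andP: (onpath_region pd).
have apd := parent_adj pd ne.
have -> : rollback lam z V y d =
    swapf (rollback lam z V y (parent G d)) (parent G d) d.
  by rewrite (rollback_parent pd er) swapfC swapfK.
have Vd : rollback lam z V y (parent G d) d = V (parent G d).
  rewrite /rollback pd er ltnSn /=; case: eqVneq => // e.
  by rewrite {1}e in er; lia.
have npy : parent G d <> y.
  by move=> e; case/and3P: pd => _; rewrite er e ltnn.
apply: slide_step_to => //.
  by rewrite Vd {1}/rollback eqxx; apply: onpath_lt_end.
move=> e De ape nd; rewrite Vd /rollback.
have re := adj_rank ape.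
rewrite (adj_neq ape).
have -> : P e = false.
  apply/negP => pe; have := onpath_rank_inj pe pd; rewrite re er => /(_ erefl) eq.
  by rewrite eq eqxx in nd.
by rewrite andbF; apply: SV => //; apply: onpath_region.
Qed.

Lemma slide_aux_rollback k f : k <= rank y - rank z -> k <= f ->
  slide_aux lam f (rollback lam z V y (iter k (parent G) y))
    (iter k (parent G) y) = V.
Proof.
elim: k f => [|k IH] f lk lf.
  rewrite /= rollback_end slide_aux_stop // => d Dd ad; apply: ltnW.
  by apply: SV ad => //; apply/onpath_region/onpath_refl.
case: f lf => // f lf; rewrite iterS /= rollback_step ?IH //; first exact: ltnW.
  by apply/(onpathP z1 z2 ry); exists k => //; apply: ltnW.
by move=> e; have [_] := reach_iter z1 z2 ry (ltnW lk); rewrite e; lia.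
Qed.

Lemma slide_rollback : slide lam z (rollback lam z V y z) = V.
Proof.
have /and3P[_ _ /eqP ez] := ry.
have := @slide_aux_rollback (rank y - rank z) (sumn lam) (leqnn _).
rewrite ez; apply; have := diag_rank Dy; rewrite /rank; lia.
Qed.

(** Connects fillings with labels: the preimage belonging to [y] has exactly the labels for which
    the row counts were computed. *)
Lemma restr_rollback :
  restr lam (blw z) (rollback lam z V y z) =1 shifted G z y.
Proof.
move=> c; rewrite {1}/restr /shifted {1}/region col_le_blw andbA -/(region lam z c).
rewrite /rollback; case: eqVneq => [_|/eqP ne]; first by rewrite andbF.
rewrite andbT; case pc: (P c); last by rewrite andbF.
rewrite (onpath_rank_gt pc ne) /=.
have Rp := onpath_region (onpath_par z1 z2 ry pc ne).
by rewrite (onpath_region pc) {2}/restr Rp.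
Qed.

Hypothesis IV : inj_diag lam V.

(** If both cells are on the path, [c] is the parent of [d] and their new entries are consecutive on
    the path. If only [c] is, its entry has decreased. If only [d] is, its new entry is the larger
    one of its two predecessors. *)
Lemma rollback_sorted : sorted_from lam (blw z) (rollback lam z V y z).
Proof.
move=> c d; rewrite /region col_le_blw => /andP[Dc /andP[lc /eqP nc]] Dd acd.
have Rc : R c by rewrite /region Dc.
have Rd := region_adj Rc Dd acd.
have ed := adj_rank acd.
have nd : d <> z.
  by move=> e; move: Rc ed; rewrite e /region /col_le /rank; move: acd;
    rewrite e /adj => /orP[]/eqP ->; rewrite /=; lia.
have Uc : rollback lam z V y z c = if P c then V (parent G c) else V c.
  rewrite /rollback; case: eqVneq => // _; case pc: (P c); last by rewrite andbF.
  by rewrite onpath_rank_gt.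
have Ud : rollback lam z V y z d = if P d then V (parent G d) else V d.
  rewrite /rollback; case: eqVneq => // _; case pd: (P d); last by rewrite andbF.
  by rewrite onpath_rank_gt.
have lpar e : P e -> e <> z -> V (parent G e) < V e.
  move=> pe ne; apply: SV; last exact: parent_adj.
    exact/onpath_region/onpath_par.
  by case/andP: (onpath_region pe).
rewrite Uc Ud; case pd: (P d); last first.
  by case pc: (P c); [apply: ltn_trans (lpar _ pc nc) _|]; apply: SV.
have pp := onpath_par z1 z2 ry pd nd.
case pc: (P c).
  have -> : parent G d = c; last exact: lpar.
  apply: onpath_rank_inj => //.
  by move: (parent_rank pd nd); rewrite ed => -[->].
have Rp := onpath_region pp.
have ncp : c <> parent G d by move=> e; rewrite -e pc in pp.
have neV : V c <> V (parent G d).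
  by move/IV => e; apply/ncp/e; [case/andP: Rc|case/andP: Rp].
(* [c] and [parent G d] are the left and the upper neighbour of [d], and [parent] selects the larger
   label. *)
suff leV : V c <= V (parent G d) by rewrite ltn_neqAle leV andbT; apply/eqP.
clear neV; move: ncp Rp acd; rewrite /parent; case: d {Dd Rd ed nd Ud pd pp} => a b.
case: ltnP => lt ncp Rp; case/orP => /eqP e.
- case: ncp; move: e; rewrite /rgt /lft; case: (c) => a' b' /= [-> ->] //.
- move: lt; rewrite {2}/restr Rp.
  have -> : abv (a, b) = c by move: e; rewrite /blw /abv; case: (c) => a' b' /= [-> ->].
  by rewrite /restr Rc; lia.
- move: lt; rewrite {2}/restr Rp.
  have -> : lft (a, b) = c by move: e; rewrite /rgt /lft; case: (c) => a' b' /= [-> ->].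
  by rewrite /restr Rc; lia.
- by case: ncp; move: e; rewrite /blw /abv; case: (c) => a' b' /= [-> ->].
Qed.

End Rollback.

Lemma reach_of_path V y : on_path (restr lam z V) z y z -> reaches (restr lam z V) z y.
Proof.
case/and3P => _ _ /eqP e; have := iter_par_le (restr lam z V) (rank y - rank z) y.
by rewrite /reaches e eqxx => -[-> ->].
Qed.

Lemma rollback_agree V y p c : rank c <= rank p -> c != p ->
  rollback lam z V y p c = V c.
Proof. by move=> le /negbTE ne; rewrite /rollback ne ltnNge le. Qed.

(** After the exchange [p] holds the old entry of [q], which exceeds the entry of any other sorted
    predecessor of [q]. Later exchanges leave these cells alone, so in [V] the reverse step from [q]
    leads back to [p]. *)
Lemma parent_swapf V y W p q : sorted_but W p -> adj p q -> D q ->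
  swapf W p q = rollback lam z V y q -> parent (restr lam z V) q = p.
Proof.
move=> [Rp S1 _] apq Dq e; have [p1 p2] := wd_gt0 diag_wd (proj1 (andP Rp)).
have [q1 q2] := wd_gt0 diag_wd Dq; have rq := adj_rank apq.
have npq : p != q by rewrite eq_sym (adj_neq apq).
have agree c : R c -> rank c <= rank q -> c != q -> V c = swapf W p q c.
  by move=> Rc le ne; rewrite e rollback_agree.
have Vp : restr lam z V p = (W q).+1.
  by rewrite /restr Rp agree ?rq // /swapf eqxx.
have lt c : adj c q -> c != p -> restr lam z V c < restr lam z V p.
  move=> acq ncp; rewrite Vp /restr; case: ifP => // Rc.
  have rc := adj_rank acq.
  have ncq : c != q by rewrite eq_sym (adj_neq acq).
  rewrite agree ?rc // /swapf (negbTE ncp) (negbTE ncq) ltnS.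
  exact: S1.
case/orP: (apq) => /eqP eq.
  have lq : lft q = p by rewrite eq /lft /rgt; case: (p).
  rewrite /parent lq lt // /adj.
    by rewrite {1}/blw /abv /=; case: (q) q1 => a b /= a0; rewrite prednK // eqxx orbT.
  by apply/eqP; rewrite -lq /abv /lft => -[]; lia.
have aq : abv q = p by rewrite eq /abv /blw; case: (p).
rewrite /parent aq ltnNge ltnW //; apply: lt.
  by rewrite /adj {1}/rgt /lft /=; case: (q) q2 => a b /= b0; rewrite prednK // eqxx.
by apply/eqP; rewrite -aq /abv /lft => -[]; lia.
Qed.

(** Converse of [slide_aux_rollback]: by induction on the fuel, each exchange performed is retraced
    by one reverse step in the final filling. *)
Lemma slide_aux_inv f W p : inj_diag lam W -> sorted_but W p ->
  rank z <= rank p -> sumn lam < f + rank p ->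
  exists V y, [/\ slide_aux lam f W p = V, sorted_from lam z V, D y,
    on_path (restr lam z V) z y p & W = rollback lam z V y p].
Proof.
have stop f' W' p' : inj_diag lam W' -> sorted_but W' p' -> rank z <= rank p' ->
  (forall d, D d -> adj p' d -> W' p' <= W' d) ->
  exists V y, [/\ slide_aux lam f' W' p' = V, sorted_from lam z V, D y,
    on_path (restr lam z V) z y p' & W' = rollback lam z V y p'].
  move=> inj S lz le; exists W', p'; have [Rp _ _] := S; split.
  - exact: slide_aux_stop.
  - exact: sorted_but_sorted le.
  - by case/andP: Rp.
  - by rewrite /on_path lz leqnn subnn /= eqxx.
  - by rewrite rollback_end.
elim: f W p => [|f IH] W p inj S lz lf.
  (* Without fuel [rank p] exceeds [sumn lam], so a successor of [p] would violate [diag_rank]. *)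
  rewrite add0n in lf; apply: stop => // d Dd apd; exfalso.
  have := diag_rank Dd.
  rewrite (adj_rank apd).
  rewrite ltnS.
  rewrite leqNgt.
  rewrite lf.
  by [].
case e: (slide_step lam W p) => [[W1 q]|]; last first.
  by apply: stop => //; apply: slide_step_None.
have [apq Dq eW lt min] := slide_step_Some e.
have [Rp _ _] := S; have Dp := proj1 (andP Rp).
have rq := adj_rank apq.
have S1 : sorted_but W1 q.
  rewrite eW; apply: sorted_but_step => // d Dd apd ne.
  rewrite ltn_neqAle min // andbT; apply: contraNneq ne => /inj ed.
  by rewrite ed.
have I1 : inj_diag lam W1 by rewrite eW; apply: inj_swapf.
have [||V [y [eV SV Dy pq eWr]]] := IH _ _ I1 S1.
- by rewrite rq ltnW.
- by rewrite rq addnS -addSn.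
have ep : parent (restr lam z V) q = p.
  by apply: (@parent_swapf V y W p q) => //; rewrite -eWr eW.
exists V, y; split=> //=; first by rewrite e.
  case/and3P: pq => h1 h2 /eqP h3; rewrite /on_path lz /=.
  have lpy : rank p < rank y by rewrite -rq.
  by rewrite (ltnW lpy) -(subnSK lpy) -rq iterS h3 ep eqxx.
by rewrite -[in RHS]ep (rollback_parent pq) ?ep // -eWr eW swapfC swapfK.
Qed.

Lemma slide_inv U : inj_diag lam U -> sorted_from lam (blw z) U ->
  exists2 y, sorted_from lam z (slide lam z U) &
    [/\ D y, reaches (restr lam z (slide lam z U)) z y
      & U = rollback lam z (slide lam z U) y z].
Proof.
move=> inj /sorted_from_blw S.
have [|V [y [eV SV Dy pz eU]]] := slide_aux_inv inj S (leqnn _) (f := sumn lam).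
  by rewrite /rank; lia.
by exists y; rewrite /slide eV //; split=> //; apply: reach_of_path.
Qed.

End Slide.
End Diagram.

(** * Counting the tabloids with a given result *)

Lemma uniq_map_inj (S T : eqType) (f : S -> T) (s : seq S) :
  uniq (map f s) -> {in s &, injective f}.
Proof.
elim: s => [|x s IH] //= /andP[nx us] a b; rewrite !inE.
case/orP=> [/eqP->|ia]; case/orP=> [/eqP->|ib] // e; last exact: IH.
- by move: nx; rewrite e map_f.
- by move: nx; rewrite -e map_f.
Qed.

Definition fot (n : nat) (U : filling) : tabtype n :=
  [ffun c => inord (U (val c.1, val c.2))].

Lemma fot_tof n (T : tabtype n) : fot n (tof T) = T.
Proof.
by apply/ffunP => -[a b]; rewrite ffunE /tof /= !ltn_ord /= !inord_val.
Qed.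

(** * Suffixes of the list of cells, and tabloids as fillings *)

Section Cells.
Variable lam : seq nat.
Hypotheses (lam_sorted : sorted geq lam).
Local Notation D := (in_diag lam).
Local Notation n := (sumn lam).

Lemma part_conjp i j : 0 < i -> 0 < j -> (j <= part lam i) = (i <= conjp lam j).
Proof.
elim: lam lam_sorted i => [|a l IH] srt i.
  by rewrite /part /conjp nth_nil /=; lia.
have sl : sorted geq l by apply: path_sorted srt.
have tr : transitive geq by move=> x y w; rewrite /geq /=; lia.
have /allP ha := order_path_min tr srt.
rewrite /conjp /= -/(conjp l j); case: i => [|[|i]] // _ j0.
  rewrite /part /=; case: (leqP j a) => //= lt.
  rewrite /conjp add0n; symmetry; apply/negbTE; rewrite -leqNgt leqn0.
  by rewrite -leqn0 leqNgt -has_count; apply/hasPn => b /ha; rewrite /geq /=; lia.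
have := IH sl i.+1 erefl j0; rewrite /part /= => e.
case: (leqP j a) => /= lt; first by rewrite e.
have -> : conjp l j = 0.
  apply/eqP; rewrite -leqn0 leqNgt -has_count.
  by apply/hasPn => b /ha; rewrite /geq /=; lia.
rewrite /=; apply/negbTE; rewrite -ltnNge; apply: leq_ltn_trans lt.
case: (ltnP i (size l)) => ls; last by rewrite nth_default.
by have := ha _ (mem_nth 0 ls).
Qed.

Lemma diag_conjp i j : D (i, j) = [&& 0 < i, 0 < j & i <= conjp lam j].
Proof.
rewrite /in_diag /=; case: (ltnP 0 i) => //= i0; case: (ltnP 0 j) => //= j0.
exact: part_conjp.
Qed.

Lemma diag_head i j : D (i, j) -> j <= head 0 lam.
Proof.
move=> Dij; have /and3P[i0 j0 _] := Dij.
have D1 : D (1, j) by apply: (wd_down (diag_wd lam) (part_anti lam_sorted) Dij).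
by move: D1; rewrite /in_diag /part /= nth0 => /andP[].
Qed.

Definition cols (j : nat) : seq cell :=
  [seq (i, j') | j' <- iota j ((head 0 lam).+1 - j), i <- iota 1 (conjp lam j')].

Definition suf (i j : nat) : seq cell :=
  [seq (i', j) | i' <- iota i ((conjp lam j).+1 - i)] ++ cols j.+1.

Lemma cells_cols : cells lam = cols 1.
Proof. by rewrite /cells /cols subSS subn0. Qed.

Lemma cols_suf j : j <= head 0 lam -> cols j = suf 1 j.
Proof. by move=> lj; rewrite /cols /suf subSn //= subSS subn0. Qed.

Lemma cols_nil : cols (head 0 lam).+1 = [::].
Proof. by rewrite /cols subnn. Qed.

Lemma suf_end j : suf (conjp lam j).+1 j = cols j.+1.
Proof. by rewrite /suf subnn. Qed.

Lemma suf_cons i j : i <= conjp lam j -> suf i j = (i, j) :: suf i.+1 j.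
Proof. by move=> li; rewrite /suf subSn //= subSS. Qed.

Lemma mem_cols j c : 0 < j -> (c \in cols j) = D c && (j <= c.2).
Proof.
case: c => a b j0; apply/allpairsPdep/idP => [[x [y []]]|].
  rewrite !mem_iota => hx hy [-> ->]; rewrite diag_conjp /=; lia.
case/andP=> Dab /= jb; have lb := diag_head Dab.
move: Dab; rewrite diag_conjp => /and3P[a0 b0 la].
by exists b, a; rewrite !mem_iota; split=> //; lia.
Qed.

Lemma mem_cells : cells lam =i D.
Proof.
move=> c; rewrite cells_cols mem_cols //; case Dc: (D c); rewrite ?Dc //=.
by rewrite -[_ \in _]/(D c) Dc; case/and3P: Dc.
Qed.

Lemma mem_suf i j c : 0 < i -> 0 < j -> (c \in suf i j) = region lam (i, j) c.
Proof.
move=> i0 j0; rewrite mem_cat mem_cols // /region /col_le /=.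
case: (ltnP j c.2) => /= lj; rewrite ?andbT ?andbF ?orbF.
  case Dc: (D c); rewrite /= ?orbT ?orbF //; apply/negbTE/mapP => -[x _ e].
  by rewrite e ltnn in lj.
case: c lj => a b /= lj; apply/mapP/idP => [[x]|].
  rewrite mem_iota => hx [-> ->]; rewrite diag_conjp eqxx; lia.
case/andP=> Dab /andP[/eqP ej ia]; subst j.
move: Dab; rewrite diag_conjp => /and3P[a0 b0 la].
by exists a => //; rewrite mem_iota; lia.
Qed.

Lemma uniq_cols j : uniq (cols j).
Proof.
apply: allpairs_uniq_dep => [|x _|]; rewrite ?iota_uniq //.
by move=> [a b] [a' b'] _ _ /= [-> ->].
Qed.

Lemma uniq_cells : uniq (cells lam).
Proof. by rewrite cells_cols uniq_cols. Qed.

Lemma region_next j : region lam ((conjp lam j).+1, j) =1 region lam (1, j.+1).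
Proof.
move=> [a b]; rewrite /region /col_le /=; case Dab: (D (a, b)) => //=.
move: Dab; rewrite diag_conjp => /and3P[a0 b0 la].
by case: (ltngtP j b) la => [lt|lt|<-] la;
  rewrite ?eqxx /=; lia.
Qed.

(** The vanishing outside the diagram makes [tof] and [fot] inverse to each other on tabloids. *)
Definition tabl (U : filling) : Prop :=
  perm_eq [seq U c | c <- cells lam] (iota 1 n) /\
  forall c, ~~ D c -> U c = 0.

Lemma tabl_inj U : tabl U -> inj_diag lam U.
Proof.
case=> pe _ c d Dc Dd; apply: (@uniq_map_inj _ _ _ (cells lam));
  rewrite ?mem_cells //.
by rewrite (perm_uniq pe) iota_uniq.
Qed.

Lemma tabl_range U c : tabl U -> D c -> 0 < U c <= n.
Proof.
case=> pe _ Dc; have : U c \in iota 1 n.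
  by rewrite -(perm_mem pe) map_f // mem_cells.
by rewrite mem_iota; lia.
Qed.

Lemma tabl_surj U k : tabl U -> 0 < k <= n -> exists2 c, D c & U c = k.
Proof.
case=> pe _ lk; have : k \in iota 1 n by rewrite mem_iota; lia.
by rewrite -(perm_mem pe) => /mapP[c]; rewrite mem_cells => Dc ->; exists c.
Qed.

Lemma tabl_le U c : tabl U -> U c <= n.
Proof.
move=> tU; case Dc: (D c); first by have /andP[] := tabl_range tU Dc.
by have [_ ->] := tU; rewrite ?Dc.
Qed.

Lemma tof_fot U : tabl U -> tof (fot n U) = U.
Proof.
move=> tU; apply: functional_extensionality => -[a b]; rewrite /tof /=.
case: ifP => [/andP[la lb]|out].
  by rewrite ffunE /= !inordK // ltnS tabl_le.
have [_ ->] := tU => //; apply/negP => Dab; have := diag_rank lam_sorted Dab.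
by move: Dab out; rewrite /in_diag /rank /=; lia.
Qed.

Lemma tabloidP (T : tabtype n) : reflect (tabl (tof T)) (is_tabloid lam T).
Proof.
apply: (iffP andP) => [[pe /forallP h]|[pe h]]; split=> //.
  move=> [a b] nD; rewrite /tof /=; case: ifP => // /andP[la lb].
  have := h (inord a, inord b); rewrite /= !inordK // nD /= => /eqP->.
  by [].
apply/forallP => -[a b]; apply/implyP => /h; rewrite /tof /= !ltn_ord /= !inord_val.
by move=> e; apply/eqP/val_inj.
Qed.

Lemma tabl_swapf U p q : D p -> D q -> tabl U -> tabl (swapf U p q).
Proof.
move=> Dp Dq [pe h]; split; last first.
  move=> c nD; rewrite /swapf; case: eqVneq => [e|_]; first by rewrite e Dp in nD.
  by case: eqVneq => [e|_]; [rewrite e Dq in nD | apply: h].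
apply: perm_trans pe.
(* Exchanging two entries is composition with the transposition [t] of their cells, which permutes
   the list of cells. *)
pose t c := if c == p then q else if c == q then p else c.
have tt : involutive t.
  move=> c; rewrite /t; have [->|np] := eqVneq c p.
    by case: eqVneq => [//|_]; rewrite eqxx.
  have [->|nq] := eqVneq c q; first by rewrite eqxx.
  by rewrite (negbTE np) (negbTE nq).
have -> : [seq swapf U p q c | c <- cells lam] = [seq U c | c <- map t (cells lam)].
  by rewrite -map_comp; apply: eq_map => c; rewrite /swapf /t /=;
    case: (c == p) => //; case: (c == q).
apply: perm_map; apply: uniq_perm; rewrite ?map_inj_uniq ?uniq_cells //.
  exact: inv_inj.
move=> c; rewrite -[c in LHS]tt mem_map; last exact: inv_inj.
rewrite !mem_cells /t -[_ \in D]/(D _) -[_ \in D]/(D _).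
by have [->|_] := eqVneq c p; rewrite ?Dq ?Dp //; have [->|_] := eqVneq c q;
  rewrite ?Dq ?Dp.
Qed.

Lemma tabl_slide_aux f U p : D p -> tabl U -> tabl (slide_aux lam f U p).
Proof.
elim: f U p => //= f IH U p Dp tU.
case e: (slide_step lam U p) => [[U' q]|] //.
have [_ Dq -> _ _] := slide_step_Some e.
by apply: IH => //; apply: tabl_swapf.
Qed.

Lemma tabl_slide U z : D z -> tabl U -> tabl (slide lam z U).
Proof. exact: tabl_slide_aux. Qed.

Lemma tabl_rollback V y z : D z -> D y -> reaches (restr lam z V) z y ->
  tabl V -> tabl (rollback lam z V y z).
Proof.
move=> Dz Dy ry tV; have [z1 z2] := wd_gt0 (diag_wd lam) Dz.
have /and3P[_ _ /eqP ez] := ry; rewrite -{2}ez.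
have : rank y - rank z <= rank y - rank z by [].
move: {-2}(rank y - rank z) => k; elim: k => [|k IH] lk; first by rewrite rollback_end.
have pd : on_path (restr lam z V) z y (iter k (parent (restr lam z V)) y).
  by apply/(onpathP z1 z2 ry); exists k => //; apply: ltnW.
have ne : iter k (parent (restr lam z V)) y <> z.
  by move=> e; have [_] := reach_iter z1 z2 ry (ltnW lk); rewrite e; lia.
have reg := onpath_region lam_sorted Dz ry Dy.
rewrite iterS rollback_parent //; last exact: (parent_rank Dz ry).
apply: tabl_swapf; last exact/IH/ltnW.
  by case/andP: (reg _ pd).
by case/andP: (reg _ (onpath_par z1 z2 ry pd ne)).
Qed.

(** Unlike [nps_from], this slides at the last cell too; [nps_from_run] shows that the two agree
    when nothing moves there. *)
Definition run (s : seq cell) (T : filling) : filling := foldr (slide lam) T s.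

Lemma tabl_run s T : {subset s <= D} -> tabl T -> tabl (run s T).
Proof.
elim: s => //= z s IH sub tT; apply: tabl_slide; first by apply: (sub z); apply: mem_head.
by apply: IH => // c cs; apply: sub; rewrite inE cs orbT.
Qed.

End Cells.

(** * The number of preimages of a partly sorted state *)

Section Counting.
Variable lam : seq nat.
Local Notation head0 := (head 0 lam).

(** Induction along the sorting: columns from right to left and each from bottom to top. The stage
    one past the foot of column [j] is identified with the top of column [j.+1]. *)
Lemma stage_ind (Q : nat -> nat -> Prop) :
  Q 1 head0.+1 ->
  (forall j, 0 < j <= head0 -> Q 1 j.+1 -> Q (conjp lam j).+1 j) ->
  (forall i j, 0 < j <= head0 -> 0 < i <= conjp lam j -> Q i.+1 j -> Q i j) ->
  forall i j, 0 < j <= head0 -> 0 < i <= (conjp lam j).+1 -> Q i j.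
Proof.
move=> Q0 Qc Qs.
have col j : 0 < j <= head0 -> Q 1 j.+1 -> forall i, 0 < i <= (conjp lam j).+1 -> Q i j.
  move=> lj q i li; rewrite -(subKn (proj2 (andP li))).
  have : (conjp lam j).+1 - i < (conjp lam j).+1 by lia.
  move: (_ - i) => k; elim: k => [|k IH] lk; first by rewrite subn0; apply: Qc.
  apply: Qs => //; first lia.
  by rewrite subnSK; [apply: IH|]; lia.
suff first j : 0 < j <= head0.+1 -> Q 1 j.
  by move=> i j lj; apply: col => //; apply: first; lia.
move=> lj; rewrite -(subKn (proj2 (andP lj))).
have : head0.+1 - j < head0.+1 by lia.
move: (_ - j) => k; elim: k => [|k IH] lk; first by rewrite subn0.
apply: col; rewrite ?ltn0Sn //; first lia.
by rewrite subnSK; [apply: IH|]; lia.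
Qed.

Hypotheses (lam_sorted : sorted geq lam).
Local Notation D := (in_diag lam).
Local Notation n := (sumn lam).

Lemma sorted_run_step z s T : D z -> tabl lam (run lam s T) ->
  sorted_from lam (blw z) (run lam s T) -> sorted_from lam z (run lam (z :: s) T).
Proof.
move=> Dz t srt; have inj := tabl_inj lam_sorted t.
by have [y] := slide_inv lam_sorted Dz inj srt.
Qed.

Lemma sorted_from_ext z z' U : region lam z =1 region lam z' ->
  sorted_from lam z U -> sorted_from lam z' U.
Proof. by move=> e S c d; rewrite -e; apply: S. Qed.

Lemma suf_sub i j : 0 < i -> 0 < j -> {subset suf lam i j <= D}.
Proof. by move=> i0 j0 c; rewrite mem_suf // => /andP[]. Qed.

Lemma conjp_head : conjp lam head0.+1 = 0.
Proof.
apply/eqP; rewrite -leqn0 leqNgt; apply/negP => c0.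
have : D (1, head0.+1) by rewrite diag_conjp.
by move/(diag_head lam_sorted); rewrite ltnn.
Qed.

Lemma cols_suf1 j : j <= head0.+1 -> cols lam j = suf lam 1 j.
Proof.
rewrite leq_eqVlt => /orP[/eqP->|lt]; last exact: cols_suf.
by rewrite cols_nil /suf conjp_head /cols (_ : head0.+1 - head0.+2 = 0) //; lia.
Qed.

Lemma suf_first_next j : j <= head0 ->
  suf lam (conjp lam j).+1 j = suf lam 1 j.+1.
Proof. by move=> lj; rewrite suf_end cols_suf1. Qed.

Lemma sorted_run i j T : 0 < j <= head0 -> 0 < i <= (conjp lam j).+1 ->
  tabl lam T -> sorted_from lam (i, j) (run lam (suf lam i j) T).
Proof.
move=> lj li tT; move: i j lj li; apply: stage_ind.
- move=> c d /andP[Dc]; have := diag_head lam_sorted (_ : D (c.1, c.2)).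
  by rewrite -surjective_pairing => /(_ Dc); rewrite /col_le /=; lia.
- move=> j /andP[j0 lj]; rewrite -suf_first_next //.
  by apply: sorted_from_ext => c; rewrite region_next.
- move=> i j /andP[j0 lj] /andP[i0 li] S; rewrite suf_cons //.
  apply: sorted_run_step => //; first by rewrite diag_conjp // i0 j0.
  by apply: tabl_run => //; apply: suf_sub.
Qed.

Definition nps (s : seq cell) (T : tabtype n) : tabtype n :=
  fot n (run lam s (tof T)).

Lemma tof_nps s T : {subset s <= D} -> is_tabloid lam T ->
  tof (nps s T) = run lam s (tof T).
Proof. by move=> sub /tabloidP tT; rewrite tof_fot //; apply: tabl_run. Qed.

Lemma tabloid_nps s T : {subset s <= D} -> is_tabloid lam T ->
  is_tabloid lam (nps s T).
Proof.
move=> sub tT; apply/tabloidP => //; rewrite tof_nps //.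
by apply: tabl_run => //; apply/tabloidP.
Qed.

Definition preimages (s : seq cell) (V : tabtype n) : nat :=
  #|[set T | is_tabloid lam T && (nps s T == V)]|.

(** The slide at [z] ends in [V] exactly when it starts from one of the rollbacks of [V], so the
    preimages split according to the rollback. *)
Lemma preimages_step z s V : D z -> {subset s <= D} ->
  (forall T : tabtype n, is_tabloid lam T ->
     sorted_from lam (blw z) (run lam s (tof T))) ->
  is_tabloid lam V -> sorted_from lam z (tof V) ->
  preimages (z :: s) V =
  \sum_(y <- cells lam | reaches (restr lam z (tof V)) z y)
     preimages s (fot n (rollback lam z (tof V) y z)).
Proof.
move=> Dz sub srt tV SV; have tabV := elimT (tabloidP V) tV.
pose R := [seq y <- cells lam | reaches (restr lam z (tof V)) z y].
have inR y : y \in R -> D y /\ reaches (restr lam z (tof V)) z y.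
  by rewrite mem_filter (mem_cells lam_sorted) => /andP[].
pose rb y := fot n (rollback lam z (tof V) y z).
have tab_rb y : y \in R -> tabl lam (rollback lam z (tof V) y z).
  by move=> /inR[Dy ry]; apply: tabl_rollback.
have tof_rb y : y \in R -> tof (rb y) = rollback lam z (tof V) y z.
  by move=> yR; rewrite tof_fot //; apply: tab_rb.
(* The rollback belonging to [y] has the entry [V y] in [z], so different [y] give different
   rollbacks. *)
have rb_inj : {in R &, injective rb}.
  move=> y y' yR y'R /(congr1 (fun U => tof U z)); rewrite !tof_rb // /rollback eqxx.
  by apply: (tabl_inj lam_sorted tabV); [case: (inR _ yR)|case: (inR _ y'R)].
have step T : is_tabloid lam T -> (nps (z :: s) T == V) =
    (nps s T \in [seq rb y | y <- R]).
  move=> tT; have tabT : tabl lam (run lam s (tof T)).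
    by apply: tabl_run => //; apply/tabloidP.
  apply/eqP/mapP => [eV|[y yR e]].
    have [y S [Dy ry e]] := slide_inv lam_sorted Dz (tabl_inj lam_sorted tabT) (srt _ tT).
    have tr : tof V = slide lam z (run lam s (tof T)).
      by rewrite -eV tof_fot //=; apply: tabl_slide.
    exists y; last by rewrite /rb tr -e.
    by rewrite mem_filter (mem_cells lam_sorted) tr ry.
  rewrite -[V]fot_tof /nps /=; congr (fot n _).
  have [Dy ry] := inR _ yR.
  have -> : run lam s (tof T) = rollback lam z (tof V) y z.
    by rewrite -tof_nps // e tof_rb.
  exact: slide_rollback.
rewrite -big_filter -/R.
rewrite -(big_map rb xpredT (fun U => preimages s U)) big_uniq /=; last first.
  by rewrite map_inj_in_uniq // filter_uniq // uniq_cells.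
rewrite /preimages -sum1_card.
rewrite (partition_big (nps s) (mem [seq rb y | y <- R])) /=; last first.
  by move=> T; rewrite inE => /andP[tT]; rewrite step.
apply: eq_bigr => U UR; rewrite -sum1_card; apply: eq_bigl => T; rewrite !inE.
case tT: (is_tabloid lam T) => //=; rewrite step //.
by case: eqP => [->|]; rewrite ?andbF // UR.
Qed.

(** Below a column top, every sorted cell has a sorted predecessor: the upper one, or in row 1 the
    left one. A reverse path therefore stays among the sorted cells until it meets [(1, j)]. *)
Lemma reach_all (V : filling) j c : 0 < j -> D (1, j) -> D c ->
  col_le (1, j) c -> reaches (restr lam (1, j) V) (1, j) c.
Proof.
move=> j0 D1; have [k] := ubnP (rank c); elim: k c => // k IH [a b] lk Dc lc.
have [->|/eqP ne] := eqVneq (a, b) (1, j); first exact: reach_root.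
have /and3P[a0 b0 _] := Dc; rewrite /= in a0 b0.
have down := wd_down (diag_wd lam) (part_anti lam_sorted) Dc.
have sup c : (0 < restr lam (1, j) V c) = D c && col_le (1, j) c by apply: restr_supp.
apply: reach_of_par => //.
have nej : a = 1 -> b <> j by move=> ea eb; apply: ne; rewrite ea eb.
suff [Dp lp] : D (parent (restr lam (1, j) V) (a, b)) /\
    col_le (1, j) (parent (restr lam (1, j) V) (a, b)).
  apply: IH => //; rewrite /rank in lk *; move: Dp lk.
  by case: (par_cases (restr lam (1, j) V) (a, b)) => -> /and3P[] /=; lia.
rewrite /parent; case: ifP => lt.
  by apply/andP; rewrite -sup; apply: leq_ltn_trans lt.
case: (ltnP 1 a) => la.
  rewrite /abv /=; split; first by apply: down => //; lia.
  by move: lc; rewrite /col_le /=; lia.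
have ea : a = 1 by lia.
have : 0 < restr lam (1, j) V (lft (a, b)).
  rewrite sup /lft ea /= /col_le /=; move: lc nej; rewrite /col_le /= ea.
  move=> lc /(_ erefl) nj; rewrite -ea.
  by rewrite down //; lia.
have : restr lam (1, j) V (abv (a, b)) = 0.
  by apply/eqP; rewrite -leqn0 leqNgt sup /abv ea /in_diag.
by move=> e0; rewrite e0 in lt; rewrite lt.
Qed.

Definition column_weight (V : filling) (i j : nat) : nat :=
  \prod_(i <= h < (conjp lam j).+1)
    (conjp lam j - h + row_count (part lam) (restr lam (i, j) V) (i, j) h).

Lemma column_weight_first V j : 0 < j ->
  column_weight V 1 j = \prod_(1 <= h < (conjp lam j).+1) hook lam (h, j).
Proof.
move=> j0; rewrite /column_weight big_nat [RHS]big_nat.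
apply: eq_bigr => h /andP[h0 hr]; have Dhj : D (h, j) by rewrite diag_conjp // h0 j0.
have /and3P[_ _ /= lj] := Dhj.
have D1 : D (1, j) by apply: (wd_down (diag_wd lam) (part_anti lam_sorted) Dhj).
suff -> : row_count (part lam) (restr lam (1, j) V) (1, j) h = (part lam h).+1 - j.
  by rewrite /hook /=; lia.
rewrite /row_count (@eq_in_count _ _ (fun m => j <= m < (part lam h).+1)).
  by rewrite count_iota_range.
move=> m; rewrite mem_iota => lm; apply/idP/idP => [/reach_ge[_ /= ->]|/andP[l1 l2]].
  by rewrite /=; lia.
apply: reach_all => //; first by rewrite /in_diag /=; lia.
by rewrite /col_le /=; lia.
Qed.

(** Initially each state has one preimage. Passing to a new column turns the finished column weight
    into hook lengths, and a slide is [preimages_step] followed by [sum_weight_shifted]. *)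
Lemma preimages_suf i j : 0 < j <= head0 -> 0 < i <= (conjp lam j).+1 ->
  forall V, is_tabloid lam V -> sorted_from lam (i, j) (tof V) ->
  preimages (suf lam i j) V =
  (\prod_(c <- cols lam j.+1) hook lam c) * column_weight (tof V) i j.
Proof.
move: i j; apply: stage_ind.
- move=> V tV _; rewrite -cols_suf1 // cols_nil /preimages.
  rewrite /column_weight conjp_head big_geq // muln1 /cols.
  rewrite (_ : head0.+1 - head0.+2 = 0) ?big_nil; last lia.
  rewrite -[RHS](cards1 V); apply: eq_card => T; rewrite !inE /nps /= fot_tof.
  by case: eqVneq => [->|_]; rewrite ?tV ?andbF.
- move=> j /andP[j0 lj] IH V tV SV; rewrite suf_first_next // IH //; last first.
    by apply: sorted_from_ext SV => c; rewrite region_next.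
  rewrite {2}/column_weight big_geq // muln1 column_weight_first //.
  by rewrite (@cols_suf1 j.+1) // /suf big_cat big_map /index_iota subSS subn0 mulnC.
- move=> i j /andP[j0 lj] /andP[i0 li] IH V tV SV.
  have Dz : D (i, j) by rewrite diag_conjp // i0 j0.
  rewrite suf_cons // preimages_step //; last 2 first.
  + exact: suf_sub.
  + by move=> T tT; apply: sorted_run; rewrite ?j0 //; apply/tabloidP.
  have tabV := elimT (tabloidP V) tV.
  have inj := tabl_inj lam_sorted tabV.
  pose G := restr lam (i, j) (tof V).
  have Gr c : 0 < G c -> D (rgt c) -> G c < G (rgt c).
    by move=> *; apply: restr_adj => //; rewrite /adj eqxx.
  have Gb c : 0 < G c -> D (blw c) -> G c < G (blw c).
    by move=> *; apply: restr_adj => //; rewrite /adj eqxx orbT.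
  have Dj h : D (h, j) -> h <= conjp lam j by rewrite diag_conjp // => /and3P[].
  rewrite big_seq_cond /column_weight.
  rewrite -(sum_weight_shifted (diag_wd lam) (part_anti lam_sorted) Dz
    (@restr_supp lam (i, j) (tof V)) Gr Gb (uniq_cells lam) (mem_cells lam_sorted) Dj).
  rewrite big_distrr /= [RHS]big_seq_cond; apply: eq_bigr => y /andP[yc ry].
  have Dy : D y by move: yc; rewrite (mem_cells lam_sorted).
  have tr : tabl lam (rollback lam (i, j) (tof V) y (i, j)) by apply: tabl_rollback.
  rewrite IH ?tof_fot //; last 2 first.
  + by apply/tabloidP => //; rewrite tof_fot.
  + exact: (rollback_sorted lam_sorted Dz ry Dy SV inj).
  congr (_ * _); apply: eq_bigr => h _; congr (_ + row_count _ _ _ _).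
  by apply: functional_extensionality => c; apply: (restr_rollback lam_sorted Dz ry Dy).
Qed.

Lemma is_sytP (T : tabtype n) :
  reflect (is_tabloid lam T /\ sorted_from lam (1, 1) (tof T)) (is_syt lam T).
Proof.
apply: (iffP andP) => -[tT S]; split=> //.
  move=> c d /andP[Dc _] Dd acd.
  have /andP[/implyP h1 /implyP h2] := allP S c (etrans (mem_cells lam_sorted c) Dc).
  by case/orP: acd => /eqP e; move: Dd; rewrite e.
apply/allP => c; rewrite (mem_cells lam_sorted) => Dc0; have Dc : D c := Dc0.
have Rc : region lam (1, 1) c.
  by rewrite /region Dc /col_le /=; have /and3P[] := Dc; lia.
by apply/andP; split; apply/implyP => Dd; apply: S => //; rewrite /adj eqxx ?orbT.
Qed.

Lemma head_gt0 U : 0 < n -> tabl lam U -> 0 < head0.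
Proof.
move=> n0 tU; case: (tabl_surj lam_sorted tU (_ : 0 < 1 <= n)) => //.
move=> [a b] Dc _; apply: leq_trans (diag_head lam_sorted Dc).
by case/and3P: Dc.
Qed.

Lemma preimages_syt V : 0 < n -> is_syt lam V ->
  preimages (cells lam) V = \prod_(c <- cells lam) hook lam c.
Proof.
move=> n0 /is_sytP[tV SV].
have h0 : 0 < head0 by apply: head_gt0 (elimT (tabloidP V) tV).
rewrite cells_cols cols_suf1 // preimages_suf ?h0 //.
rewrite column_weight_first // /suf big_cat big_map /index_iota subSS subn0 mulnC.
by [].
Qed.

Lemma syt_nps T : 0 < n -> is_tabloid lam T -> is_syt lam (nps (cells lam) T).
Proof.
move=> n0 tT; have sub : {subset cells lam <= D}.
  by move=> c; rewrite (mem_cells lam_sorted).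
apply/is_sytP; split; first exact: tabloid_nps.
have h0 : 0 < head0 by apply: head_gt0 (elimT (tabloidP T) tT).
rewrite tof_nps // cells_cols cols_suf1 //.
by apply: sorted_run; rewrite ?h0 //; apply/tabloidP.
Qed.

End Counting.

(** * Exchanging consecutive entries, and drops *)

Definition swap_val (b v : nat) : nat :=
  if v == b then b.+1 else if v == b.+1 then b else v.

Lemma swap_valK b : involutive (swap_val b).
Proof.
move=> v; rewrite /swap_val; have [->|nb] := eqVneq v b.
  by rewrite eqxx; case: eqVneq => // e; lia.
have [->|nb1] := eqVneq v b.+1; first by rewrite eqxx.
by rewrite (negbTE nb) (negbTE nb1).
Qed.

Lemma swap_val_eq b v w : (swap_val b v == w) = (v == swap_val b w).
Proof. by rewrite -{2}(swap_valK b v) (inj_eq (inv_inj (swap_valK b))). Qed.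

(** The exchange inverts only the pair [b], [b.+1], so it preserves the order of values other than
    [b.+1]. *)
Lemma swap_val_lt b u v : u != b.+1 -> v != b.+1 -> u < v ->
  swap_val b u < swap_val b v.
Proof.
move=> nu nv; rewrite /swap_val (negbTE nu) (negbTE nv).
by case: eqVneq => eu; case: eqVneq => ev; lia.
Qed.

Section SwapSlide.
Variable lam : seq nat.
Hypotheses (lam_sorted : sorted geq lam).
Local Notation D := (in_diag lam).
Local Notation n := (sumn lam).

Lemma slide_aux_frame z f U p c : D z -> region lam z p -> ~~ region lam z c ->
  slide_aux lam f U p c = U c.
Proof.
move=> Dz; elim: f U p => //= f IH U p Rp Rc.
case e: (slide_step lam U p) => [[U' q]|] //.
have [apq Dq -> _ _] := slide_step_Some e.
have Rq := region_adj lam_sorted Dz Rp Dq apq.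
rewrite IH // /swapf; case: eqVneq => [e1|_]; first by rewrite e1 Rp in Rc.
by case: eqVneq => [e1|//]; rewrite e1 Rq in Rc.
Qed.

Lemma region_root z : D z -> region lam z z.
Proof. by move=> Dz; rewrite /region Dz /col_le eqxx leqnn orbT. Qed.

Lemma region_blw z c : region lam (blw z) c -> region lam z c.
Proof. by rewrite /region col_le_blw => /andP[-> /andP[->]]. Qed.

Lemma run_frame i j T c : 0 < j <= head 0 lam -> 0 < i <= (conjp lam j).+1 ->
  ~~ region lam (i, j) c -> run lam (suf lam i j) T c = T c.
Proof.
move=> lj li; move: i j lj li; apply: (stage_ind (lam := lam)).
- by move=> nR; rewrite -cols_suf1 // cols_nil.
- move=> j /andP[j0 lj] IH nR; rewrite suf_first_next // IH //.
  by rewrite -region_next.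
- move=> i j /andP[j0 lj] /andP[i0 li] IH nR.
  have Dz : D (i, j) by rewrite diag_conjp // i0 j0.
  rewrite suf_cons //= /slide (slide_aux_frame (z := (i, j))) ?region_root //.
  by rewrite IH //; apply: contra nR => /(@region_blw (i, j)).
Qed.

(** The moving entry is exchanged only with smaller ones, so an entry above it keeps its place. *)
Lemma slide_aux_large f U p k c : U p < k ->
  (slide_aux lam f U p c == k) = (U c == k).
Proof.
elim: f U p => //= f IH U p lt.
case e: (slide_step lam U p) => [[U' q]|] //.
have [_ _ -> lt' _] := slide_step_Some e.
rewrite IH; last first.
  by rewrite /swapf eqxx; case: eqVneq => // _; apply: ltn_trans lt.
rewrite /swapf; have [->|_] := eqVneq c p.
  by rewrite !ltn_eqF // (ltn_trans lt').
by have [->|//] := eqVneq c q; rewrite !ltn_eqF // (ltn_trans lt').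
Qed.

Lemma slide_step_strict U p U' q d : tabl lam U ->
  slide_step lam U p = Some (U', q) -> D d -> adj p d -> d != q -> U q < U d.
Proof.
move=> tU e Dd apd ne; have [_ Dq _ _ min] := slide_step_Some e.
rewrite ltn_neqAle min // andbT; apply: contraNneq ne.
by move/(tabl_inj lam_sorted tU) => ->.
Qed.

Lemma swapf_comp (f : nat -> nat) U p q : swapf (f \o U) p q = f \o swapf U p q.
Proof.
apply: functional_extensionality => c; rewrite /swapf /=.
by case: (c == p); case: (c == q).
Qed.

(** A slide sees only comparisons between entries of the sorted region; these are preserved when
    [b.+1] is not among them. *)
Lemma slide_aux_swap_val z b f U p : D z -> tabl lam U -> region lam z p ->
  (forall c, region lam z c -> U c != b.+1) ->
  slide_aux lam f (swap_val b \o U) p = swap_val b \o slide_aux lam f U p.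
Proof.
move=> Dz; elim: f U p => //= f IH U p tU Rp nb.
case e: (slide_step lam U p) => [[U' q]|]; last first.
  rewrite slide_step_stop // => d Dd apd /=.
  have := slide_step_None e Dd apd; rewrite leq_eqVlt => /orP[/eqP->//|lt].
  by apply/ltnW/swap_val_lt => //; apply: nb => //; apply: (region_adj lam_sorted Dz Rp).
have [apq Dq eU lt _] := slide_step_Some e.
have Rq := region_adj lam_sorted Dz Rp Dq apq.
rewrite (slide_step_to apq Dq) /=; last 2 first.
- by apply: swap_val_lt => //; apply: nb.
- move=> d Dd apd ne; apply: swap_val_lt; rewrite ?nb //.
    exact: (region_adj lam_sorted Dz Rp).
  exact: slide_step_strict e Dd apd ne.
rewrite swapf_comp -eU; apply: IH => //; rewrite eU.
  by apply: tabl_swapf => //; case/andP: Rp.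
by move=> c Rc; rewrite /swapf; case: (c == p); [|case: (c == q)]; apply: nb.
Qed.

Lemma tabl_neq0_inj U c d : tabl lam U -> 0 < U c -> U c = U d -> c = d.
Proof.
move=> tU c0 e; have inD a : 0 < U a -> D a.
  by move=> a0; apply/negPn/negP => /(proj2 tU) e0; rewrite e0 in a0.
by apply: (tabl_inj lam_sorted tU); [apply: inD|apply: inD; rewrite -e|].
Qed.

(* The two slides move in parallel unless the sliding entry [b.+1] meets [b];
   then it passes [b] and stops, whereas [b] stops before [b.+1]. *)
Lemma slide_aux_swap_top z b f U p : D z -> 0 < b -> tabl lam U ->
  sorted_but lam z U p -> U p = b.+1 ->
  (slide_aux lam f (swap_val b \o U) p = swap_val b \o slide_aux lam f U p /\
   forall c, (slide_aux lam f U p c == b) = (U c == b)) \/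
  (slide_aux lam f (swap_val b \o U) p = slide_aux lam f U p /\
   forall c, (slide_aux lam f U p c == b.+1) = (U c == b)).
Proof.
move=> Dz b0; elim: f U p => [|f IH] U p tU S Up; first by left.
have uniq_top c : U c = b.+1 -> c = p.
  by move=> e; apply: tabl_neq0_inj tU _ _; rewrite e.
have [Rp S1 _] := S; have Dp := proj1 (andP Rp).
have nbr d : adj p d -> U d != b.+1.
  by move=> apd; apply/eqP => /uniq_top e; have := adj_neq apd; rewrite e eqxx.
rewrite /=; case e: (slide_step lam U p) => [[U' q]|]; last first.
  left; split=> //; rewrite slide_step_stop // => d Dd apd /=.
  have := slide_step_None e Dd apd.
  rewrite Up leq_eqVlt eq_sym (negbTE (nbr _ apd)) /= => lt.
  rewrite /swap_val eqxx (negbTE (nbr _ apd)).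
  by case: eqVneq => e1; case: eqVneq => e2; lia.
have [apq Dq eU lt _] := slide_step_Some e.
have strict := slide_step_strict tU e.
have npq : q != p by rewrite (adj_neq apq).
have [Uq|nUq] := eqVneq (U q) b.
  right.
  (* With [b.+1] in [p] and [b] in [q], exchanging the values is exchanging the cells. *)
  have sw : swap_val b \o U = swapf U p q.
    apply: functional_extensionality => c; rewrite /= /swapf /swap_val.
    have [->|ncp] := eqVneq c p; first by rewrite Up Uq eqxx; case: eqVneq => // ?; lia.
    have [->|ncq] := eqVneq c q; first by rewrite Uq Up eqxx.
    case: eqVneq => [ecb|_].
      have eq : c = q by apply: tabl_neq0_inj tU _ _; rewrite ecb ?Uq.
      by rewrite eq eqxx in ncq.
    by case: eqVneq => // /uniq_top ecp; rewrite ecp eqxx in ncp.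
  have -> : slide_aux lam f U' q = swapf U p q.
    rewrite eU slide_aux_stop // => d Dd aqd.
    rewrite /swapf eqxx (negbTE npq) (adj_neq2 apq aqd) (adj_neq aqd) Up.
    by have := S1 q d (region_adj lam_sorted Dz Rp Dq apq) Dd aqd npq; rewrite Uq.
  split; last first.
    by move=> c; rewrite -sw /= swap_val_eq /swap_val eqxx (gtn_eqF (ltnSn b)).
  rewrite slide_step_stop // => d Dd apd /=; rewrite /swap_val Up eqxx.
  have -> : (b.+1 == b) = false by rewrite gtn_eqF.
  have [->|nd] := eqVneq d q; first by rewrite Uq eqxx.
  have lt' := strict _ Dd apd nd; rewrite Uq in lt'.
  by rewrite (negbTE (nbr _ apd)) (gtn_eqF lt') ltnW.
have lqb : U q < b by rewrite Up in lt; lia.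
have sq : swap_val b (U q) = U q.
  by rewrite /swap_val (negbTE nUq) (negbTE (nbr _ apq)).
rewrite (slide_step_to apq Dq) /=; last 2 first.
- by rewrite sq Up /swap_val eqxx; case: eqVneq => // ?; lia.
- by move=> d Dd apd ne; apply: swap_val_lt; rewrite ?nbr // strict.
rewrite swapf_comp -eU.
have U'p c : (U' c == b) = (U c == b).
  rewrite eU /swapf; have [->|_] := eqVneq c p.
    by rewrite Up (negbTE nUq); symmetry; apply/eqP; lia.
  have [->|_] := eqVneq c q; last by [].
  by rewrite Up (negbTE nUq); apply/eqP; lia.
have := IH U' q; rewrite eU; case.
- exact: tabl_swapf.
- by apply: sorted_but_step.
- by rewrite /swapf eqxx (negbTE npq) Up.
- by rewrite -eU => -[-> h]; left; split=> // c; rewrite h U'p.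
- by rewrite -eU => -[-> h]; right; split=> // c; rewrite h U'p.
Qed.

Lemma run_swap_val i j b T z : 0 < j <= head 0 lam -> 0 < i <= (conjp lam j).+1 ->
  tabl lam T -> T z = b.+1 -> ~~ region lam (i, j) z ->
  run lam (suf lam i j) (swap_val b \o T) = swap_val b \o run lam (suf lam i j) T.
Proof.
move=> lj li tT Tz; move: i j lj li; apply: (stage_ind (lam := lam)).
- by move=> nR; rewrite -cols_suf1 // cols_nil.
- move=> j /andP[j0 lj] IH nR; rewrite suf_first_next // IH //.
  by rewrite -region_next.
- move=> i j /andP[j0 lj] /andP[i0 li] IH nR.
  have Dz : D (i, j) by rewrite diag_conjp // i0 j0.
  have nR' : ~~ region lam (i.+1, j) z by apply: contra nR => /(@region_blw (i, j)).
  have tU : tabl lam (run lam (suf lam i.+1 j) T).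
    by apply: tabl_run => //; apply: suf_sub.
  rewrite suf_cons //= IH //; apply: (slide_aux_swap_val (z := (i, j))) => //.
    exact: region_root.
  move=> c Rc; apply/eqP => e.
  have : c = z; last by move=> ez; rewrite -ez Rc in nR.
  apply: tabl_neq0_inj tU _ _; rewrite e //.
  by rewrite run_frame // j0.
Qed.

End SwapSlide.

(** * The states before and after the slide at a given cell *)

Section Suffix.
Variable lam : seq nat.
Hypotheses (lam_sorted : sorted geq lam).
Local Notation D := (in_diag lam).
Local Notation n := (sumn lam).

Lemma cells_suf z : D z -> exists A, cells lam = A ++ suf lam z.1 z.2.
Proof.
case: z => i j Dz; have lj := diag_head lam_sorted Dz.
move: Dz; rewrite diag_conjp //= => /and3P[i0 j0 li].
have [B eB] : exists B, cells lam = B ++ cols lam j.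
  exists [seq (i', j') | j' <- iota 1 j.-1, i' <- iota 1 (conjp lam j')].
  rewrite cells_cols /cols -flatten_cat -map_cat.
  have -> : (head 0 lam).+1 - 1 = j.-1 + ((head 0 lam).+1 - j) by lia.
  by rewrite iotaD add1n prednK.
exists (B ++ [seq (i', j) | i' <- iota 1 i.-1]).
rewrite eB (cols_suf lj) -catA; congr (_ ++ _); rewrite /suf catA -map_cat.
have -> : (conjp lam j).+1 - 1 = i.-1 + ((conjp lam j).+1 - i) by lia.
by rewrite iotaD add1n prednK.
Qed.

Lemma drop_index_cells z : D z ->
  drop (index z (cells lam)) (cells lam) = suf lam z.1 z.2 /\
  drop (index z (cells lam)).+1 (cells lam) = suf lam z.1.+1 z.2.
Proof.
move=> Dz; have [A e] := cells_suf Dz; have := uniq_cells lam; rewrite e.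
have es : suf lam z.1 z.2 = z :: suf lam z.1.+1 z.2.
  rewrite suf_cons -?surjective_pairing //.
  by move: Dz; rewrite [z]surjective_pairing diag_conjp // => /and3P[].
rewrite cat_uniq => /and3P[_ hA _].
have zA : z \notin A.
  by apply: contra hA => zA; apply/hasP; exists z; rewrite // es mem_head.
rewrite index_cat (negbTE zA) es /= eqxx addn0 drop_size_cat //; split=> //.
by rewrite -[(size A).+1]addn1 addnC -drop_drop drop_size_cat //= drop0.
Qed.

(** A right or lower neighbour comes later in the order of cells, so the last cell has none. *)
Lemma last_stage i j : 0 < j <= head 0 lam -> 0 < i <= (conjp lam j).+1 ->
  forall s w d, suf lam i j = rcons s w -> D d -> adj w d -> False.
Proof.
move: i j; apply: (stage_ind (lam := lam)).
- by move=> s w d; rewrite -cols_suf1 // cols_nil; case: s.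
- by move=> j /andP[j0 lj] IH s w d; rewrite suf_first_next //; apply: IH.
- move=> i j /andP[j0 lj] /andP[i0 li] IH [|x s] w d; rewrite suf_cons //=;
    last by case=> _; apply: IH.
  case=> <- e Dd ad.
  have Dz : D (i, j) by rewrite diag_conjp // i0 j0.
  have : d \in suf lam i.+1 j.
    rewrite mem_suf // /region -[(i.+1, j)]/(blw (i, j)) col_le_blw (adj_neq ad) andbT.
    exact: (region_adj lam_sorted Dz (region_root Dz) Dd ad).
  by rewrite e.
Qed.

Lemma nps_from_run s T :
  (forall s' w, s = rcons s' w -> slide lam w T = T) -> nps_from lam s T = run lam s T.
Proof.
elim: s => [//|z [|z' s] IH] h; first by rewrite /= (h [::]).
rewrite -[RHS]/(slide lam z (run lam (z' :: s) T)) -IH // => s' w e.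
by apply: (h (z :: s')); rewrite e.
Qed.

Definition aft (z : cell) (T : filling) : filling := run lam (suf lam z.1 z.2) T.
Definition bef (z : cell) (T : filling) : filling := run lam (suf lam z.1.+1 z.2) T.

Lemma diag_stage z : D z -> 0 < z.2 <= head 0 lam /\ 0 < z.1 <= conjp lam z.2.
Proof.
case: z => i j Dz; have := diag_head lam_sorted Dz; move: Dz.
by rewrite diag_conjp // => /and3P[-> -> ->] ->.
Qed.

Lemma diag_stage_next z : D z ->
  0 < z.2 <= head 0 lam /\ 0 < z.1.+1 <= (conjp lam z.2).+1.
Proof. by case/diag_stage=> hj /andP[_ hi]. Qed.

Lemma aft_slide z T : D z -> aft z T = slide lam z (bef z T).
Proof.
move=> /diag_stage[_ /andP[_ li]].
by rewrite /aft suf_cons //= -surjective_pairing.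
Qed.

Lemma nps_at_aft z T : D z -> nps_at lam T z = aft z T.
Proof.
move=> Dz; have [hj /andP[hi hc]] := diag_stage Dz.
rewrite /nps_at (proj1 (drop_index_cells Dz)); apply: nps_from_run => s w e.
rewrite /slide slide_aux_stop // => d Dd ad.
by case: (last_stage hj _ e Dd ad); rewrite hi ltnW.
Qed.

Lemma tabl_bef z T : D z -> tabl lam T -> tabl lam (bef z T).
Proof.
move=> Dz tT; have [/andP[j0 _] _] := diag_stage Dz.
by apply: tabl_run => //; apply: suf_sub.
Qed.

Lemma sorted_bef z T : D z -> tabl lam T -> sorted_but lam z (bef z T) z.
Proof.
move=> Dz tT; have [hj hi] := diag_stage_next Dz.
apply: sorted_from_blw => //; exact: (sorted_run lam_sorted hj hi tT).
Qed.

Lemma bef_self z T : D z -> bef z T z = T z.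
Proof.
move=> Dz; have [hj hi] := diag_stage_next Dz.
apply: run_frame => //.
by rewrite /region -[(_, _)]/(blw z) col_le_blw eqxx !andbF.
Qed.

Lemma bef_swap_val z b T : D z -> tabl lam T -> T z = b.+1 ->
  bef z (swap_val b \o T) = swap_val b \o bef z T.
Proof.
move=> Dz tT Tz; have [hj hi] := diag_stage_next Dz.
apply: (run_swap_val lam_sorted hj hi tT Tz).
by rewrite /region -[(_, _)]/(blw z) col_le_blw eqxx !andbF.
Qed.

End Suffix.

(** * Drops and the change caused by each slide *)

Import GRing.Theory Num.Theory.
Local Open Scope ring_scope.

Lemma sum_drop_index (V : zmodType) (T : eqType) (s : seq T) (g : seq T -> V) :
  uniq s ->
  \sum_(z <- s) (g (drop (index z s) s) - g (drop (index z s).+1 s)) =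
  g s - g [::].
Proof.
elim: s => [|a s IH] /=; first by rewrite big_nil subrr.
move=> /andP[na us]; rewrite big_cons /= eqxx !drop0.
rewrite (eq_big_seq (fun z => g (drop (index z s) s) - g (drop (index z s).+1 s))).
  by rewrite IH // addrA subrK.
by move=> z zs; case: eqVneq => [e|//]; rewrite e zs in na.
Qed.

Lemma natr_card_cond (T : finType) (P Q : pred T) :
  (#|[set t | P t && Q t]|%:R : rat) = \sum_(t | P t) (Q t)%:R.
Proof.
rewrite -sum1_card natr_sum [LHS](eq_bigl (fun t => P t && Q t)); last first.
  by move=> t; rewrite inE.
by rewrite big_mkcondr; apply: eq_bigr => t _; case: (Q t).
Qed.

Section Drop.
Variable lam : seq nat.
Hypotheses (lam_sorted : sorted geq lam).
Local Notation D := (in_diag lam).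
Local Notation n := (sumn lam).
Local Notation dropr k x := ((dropf lam k x)%:R : rat).

Lemma sum_cell_at (T : filling) (F : cell -> rat) z0 k : tabl lam T -> D z0 ->
  T z0 = k -> \sum_(z <- cells lam) (T z == k)%:R * F z = F z0.
Proof.
move=> tT Dz e; have zc : z0 \in cells lam by rewrite (mem_cells lam_sorted).
rewrite (bigD1_seq z0) ?uniq_cells //= e eqxx mul1r.
rewrite big_seq_cond big1 ?addr0 // => z /andP[zc' ne].
case: eqP => [ez|_]; last by rewrite mul0r.
have ezz : z = z0.
  apply: (tabl_inj lam_sorted tT) => //; last by rewrite ez e.
  by rewrite -(mem_cells lam_sorted).
by rewrite ezz eqxx in ne.
Qed.

(** In a tabloid only the cell holding [b] contributes: the change of the indicator of [k] being in
    [x] during the slide of [b]. *)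
Definition change (b k : nat) (x : cell) (T : filling) : rat :=
  \sum_(z <- cells lam) (T z == b)%:R *
    ((aft lam z T x == k)%:R - (bef lam z T x == k)%:R).

Definition final (k : nat) (x : cell) : rat :=
  \sum_(T : tabtype n | is_tabloid lam T) (run lam (cells lam) (tof T) x == k)%:R.

Lemma dropf_sum k x : (0 < k <= n)%N -> dropr k x =
  \sum_(T : tabtype n | is_tabloid lam T) \sum_(z <- cells lam)
     (tof T z == k)%:R * (aft lam z (tof T) x == k)%:R.
Proof.
move=> lk; rewrite /dropf natr_card_cond; apply: eq_bigr => T /tabloidP tabT.
have [z0 Dz e] := tabl_surj lam_sorted tabT lk.
rewrite (sum_cell_at _ tabT Dz e); congr (_%:R); congr nat_of_bool.
apply/hasP/idP => [[z]|ax].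
  rewrite (mem_cells lam_sorted) => Dz' /andP[/eqP ez]; rewrite nps_at_aft //.
  by have -> : z = z0 by apply: (tabl_inj lam_sorted tabT) => //; rewrite ez e.
exists z0; first by rewrite (mem_cells lam_sorted).
by rewrite e eqxx nps_at_aft.
Qed.

Lemma sum_change T k x : tabl lam T ->
  \sum_(1 <= b < n.+1) change b k x T =
  (run lam (cells lam) T x == k)%:R - (T x == k)%:R.
Proof.
move=> tT; rewrite /change exchange_big /=.
rewrite -(sum_drop_index (fun s => (run lam s T x == k)%:R : rat) (uniq_cells lam)).
apply: eq_big_seq => z; rewrite (mem_cells lam_sorted) => Dz.
have [-> ->] := drop_index_cells lam_sorted Dz.
rewrite -big_distrl /= -[RHS]mul1r; congr (_ * _).
have lz := tabl_range lam_sorted tT Dz.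
rewrite (bigD1_seq (T z)) ?iota_uniq //=; last by rewrite mem_index_iota.
by rewrite eqxx big1 ?addr0 // => b; rewrite eq_sym => /negbTE->.
Qed.

Lemma change_small b k x T : tabl lam T -> (b < k)%N -> change b k x T = 0.
Proof.
move=> tT lt; rewrite /change big_seq big1 // => z.
rewrite (mem_cells lam_sorted) => Dz; case: eqP => [e|_]; last by rewrite mul0r.
rewrite aft_slide // /slide slide_aux_large ?subrr ?mulr0 //.
by rewrite bef_self // e.
Qed.

(** Earlier slides do not touch the cell of [k], so [k] is still in its original place when its own
    slide begins. *)
Lemma change_self k x T : tabl lam T -> (0 < k <= n)%N -> change k k x T =
  \sum_(z <- cells lam) (T z == k)%:R * (aft lam z T x == k)%:R - (T x == k)%:R.
Proof.
move=> tT lk; have [z0 Dz e] := tabl_surj lam_sorted tT lk.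
rewrite /change !(sum_cell_at _ tT Dz e); congr (_ - _).
have tb := tabl_bef lam_sorted Dz tT.
have k0 : (0 < k)%N by case/andP: lk.
have key U : tabl lam U -> U z0 = k -> (U x == k) = (x == z0).
  move=> tU eU; apply/eqP/eqP => [ex|->//].
  by apply: (tabl_neq0_inj lam_sorted tU); rewrite ?ex ?eU.
by rewrite !key // bef_self.
Qed.

Definition swap_tab (b : nat) (T : tabtype n) : tabtype n :=
  [ffun c => inord (swap_val b (T c))].

Lemma swap_val_le b v : (b < n)%N -> (v <= n)%N -> (swap_val b v <= n)%N.
Proof. by rewrite /swap_val; case: eqVneq => _; [|case: eqVneq => _]; lia. Qed.

Lemma tof_swap_tab b T : (0 < b < n)%N -> tof (swap_tab b T) = swap_val b \o tof T.
Proof.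
move=> /andP[b0 bn]; apply: functional_extensionality => c; rewrite /tof /=.
case: ifP => _; last by rewrite /swap_val; case: eqVneq => [e|_]; rewrite -?e // in b0 *.
by rewrite ffunE inordK // ltnS swap_val_le // -ltnS.
Qed.

Lemma swap_tabK b : (0 < b < n)%N -> involutive (swap_tab b).
Proof.
move=> hb T; rewrite -[LHS]fot_tof -[RHS]fot_tof !tof_swap_tab //; congr (fot n _).
by apply: functional_extensionality => c /=; rewrite swap_valK.
Qed.

Lemma tabl_swap_val b U : (0 < b < n)%N -> tabl lam U -> tabl lam (swap_val b \o U).
Proof.
move=> /andP[b0 bn] [pe h]; split; last first.
  by move=> c /h /= ->; rewrite /swap_val; case: (b) b0.
rewrite (map_comp (swap_val b) U); apply: perm_trans (perm_map _ pe) _.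
apply: uniq_perm; rewrite ?map_inj_uniq ?iota_uniq //; first exact/inv_inj/swap_valK.
move=> v; rewrite -[v in LHS](swap_valK b) mem_map; last exact/inv_inj/swap_valK.
rewrite !mem_iota /swap_val; case: eqVneq => [->|_]; first lia.
by case: eqVneq => [->|//]; lia.
Qed.

Lemma is_tabloid_swap b T : (0 < b < n)%N ->
  is_tabloid lam (swap_tab b T) = is_tabloid lam T.
Proof.
move=> hb; have imp T' : is_tabloid lam T' -> is_tabloid lam (swap_tab b T').
  move=> /tabloidP tT; apply/tabloidP => //; rewrite tof_swap_tab //.
  exact: tabl_swap_val.
by apply/idP/idP; [rewrite -{2}(swap_tabK hb T)|]; apply: imp.
Qed.

Lemma reindex_swap b (F : filling -> rat) : (0 < b < n)%N ->
  \sum_(T : tabtype n | is_tabloid lam T) F (tof T) =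
  \sum_(T : tabtype n | is_tabloid lam T) F (swap_val b \o tof T).
Proof.
move=> hb; rewrite (reindex_inj (inv_inj (swap_tabK hb))).
by apply: eq_big => [T|T _]; rewrite ?is_tabloid_swap ?tof_swap_tab.
Qed.

Lemma swap_val_out b k : (k < b)%N -> swap_val b k = k.
Proof. by rewrite /swap_val => lt; do 2!(case: eqVneq => [?|_]; first lia). Qed.

Lemma swap_val_l b : swap_val b b = b.+1.
Proof. by rewrite /swap_val eqxx. Qed.

Lemma swap_val_at b v : (swap_val b v == b) = (v == b.+1).
Proof. by rewrite swap_val_eq swap_val_l. Qed.

(** In both cases of [slide_aux_swap_top] the two slides differ at most in the places of [b] and
    [b.+1], so they move [k < b] alike. *)
Lemma change_swap b k x T : tabl lam T -> (0 < k < b)%N -> (b < n)%N ->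
  change b.+1 k x T = change b k x (swap_val b \o T).
Proof.
move=> tT /andP[k0 kb] bn; apply: eq_big_seq => z; rewrite (mem_cells lam_sorted) => Dz.
rewrite /= swap_val_at.
case: eqP => [e|_]; last by rewrite !mul0r.
rewrite !aft_slide // bef_swap_val //=.
have b0 : (0 < b)%N by lia.
have := slide_aux_swap_top lam_sorted n Dz b0 (tabl_bef lam_sorted Dz tT)
  (sorted_bef lam_sorted Dz tT).
rewrite bef_self // => /(_ e) [][h _];
  by rewrite /slide h /= !swap_val_eq swap_val_out.
Qed.

(** If the slide of [k.+1] does not pass [k], both sides vanish. If it does, [k.+1] stops where [k]
    was, and the [k] of the exchanged tabloid ends where the [k] of [T] is pushed to. *)
Lemma change_next k x T : tabl lam T -> (0 < k < n)%N ->
  change k.+1 k x T =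
  \sum_(z <- cells lam) ((swap_val k \o T) z == k)%:R *
     (aft lam z (swap_val k \o T) x == k)%:R -
  \sum_(z <- cells lam) (T z == k.+1)%:R * (aft lam z T x == k.+1)%:R.
Proof.
move=> tT /andP[k0 kn]; rewrite -sumrB; apply: eq_big_seq => z.
rewrite (mem_cells lam_sorted) => Dz.
rewrite /= swap_val_at.
case: eqP => [e|_]; last by rewrite !mul0r subrr.
rewrite !mul1r !aft_slide // bef_swap_val //=.
have := slide_aux_swap_top lam_sorted n Dz k0 (tabl_bef lam_sorted Dz tT)
  (sorted_bef lam_sorted Dz tT).
rewrite bef_self // => /(_ e) [][h h'].
  by rewrite /slide h /= swap_val_at h' !subrr.
by rewrite /slide h h'.
Qed.

(** Among the changes summed in [sum_change], those of [b < k] vanish, and that of [k] itself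
    replaces the initial position by the drop. *)
Lemma final_drop k x : (0 < k <= n)%N -> final k x =
  dropr k x +
  \sum_(k.+1 <= b < n.+1) \sum_(T : tabtype n | is_tabloid lam T) change b k x (tof T).
Proof.
move=> /andP[k0 kn]; rewrite dropf_sum ?k0 // [X in _ = _ + X]exchange_big -big_split /=.
apply: eq_bigr => T /tabloidP tabT.
have := sum_change k x tabT.
rewrite (@big_cat_nat _ _ _ k) //=; last exact: leqW.
rewrite big_nat big1 ?add0r; last first.
  by move=> b /andP[_ lt]; apply: change_small.
rewrite big_ltn // change_self ?k0 // => e.
by apply: (addIr (- (tof T x == k)%:R)); rewrite -e addrAC.
Qed.

Lemma final_rec k x : (0 < k < n)%N -> final k x =
  dropr k x + (n - k)%:R * (dropr k x - dropr k.+1 x).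
Proof.
move=> /andP[k0 kn]; rewrite final_drop ?k0 ?(ltnW kn) //; congr (_ + _).
(* All [b > k] give the same total: [change_swap] lowers [b] step by step to [k.+1], where
   [change_next] evaluates it. *)
have const b : (k < b <= n)%N ->
    \sum_(T : tabtype n | is_tabloid lam T) change b k x (tof T) =
    dropr k x - dropr k.+1 x.
  elim: b => [|b IH] // /andP[kb bn].
  rewrite ltnS in kb; case: (ltngtP k b) kb => // [lt _|e _].
    have bn' : (0 < b < n)%N by rewrite (leq_ltn_trans _ lt).
    rewrite -IH ?lt ?(ltnW bn) // (reindex_swap (change b k x) bn').
    by apply: eq_bigr => T /tabloidP tT; apply: change_swap; rewrite ?k0.
  rewrite -e !dropf_sum ?k0 ?(ltnW kn) ?kn //.
  rewrite (@reindex_swap k (fun U => \sum_(z <- cells lam) (U z == k)%:R *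
    (aft lam z U x == k)%:R)) ?k0 // -sumrB.
  by apply: eq_bigr => T /tabloidP tT; apply: change_next; rewrite ?k0.
transitivity (\sum_(k.+1 <= b < n.+1) (dropr k x - dropr k.+1 x)).
  by apply: eq_big_nat => b hb; apply: const.
by rewrite sumr_const_nat subSS mulr_natl.
Qed.

Lemma final_top x : (0 < n)%N -> final n x = dropr n x.
Proof. by move=> n0; rewrite final_drop ?n0 ?leqnn // big_geq // addr0. Qed.

(** [final_rec] says that [(n - k + 1) d(k,x)] is [final k x] plus [(n - k) d(k+1,x)]; unrolling
    this from [k = n] downwards gives the sum. *)
Lemma dropf_final k x : (0 < k <= n)%N ->
  (n - k + 1)%:R * dropr k x = \sum_(k <= l < n.+1) final l x.
Proof.
move=> /andP[k0 kn]; rewrite -(subKn kn); have : (n - k < n)%N by lia.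
move: (n - k)%N => m; elim: m => [|m IH] lm.
  by rewrite subn0 subnn mul1r big_nat1 final_top.
rewrite big_ltn; last by lia.
have -> : (n - m.+1).+1 = (n - m)%N by lia.
rewrite -IH 1?ltnW // final_rec; last by lia.
have -> : (n - m.+1).+1 = (n - m)%N by lia.
have -> : (n - (n - m.+1) = m.+1)%N by lia.
have -> : (n - (n - m) = m)%N by lia.
by rewrite !addn1 -[m.+2]add1n natrD mulrDl mul1r mulrBr -addrA subrK.
Qed.

(** The fibres of the full sorting over standard tableaux all have the size found in
    [preimages_syt]. *)
Lemma sum_preimages (Q : pred (tabtype n)) : (0 < n)%N ->
  #|[set T | is_tabloid lam T && Q (nps (cells lam) T)]| =
  (#|[set S | is_syt lam S && Q S]| * \prod_(c <- cells lam) hook lam c)%N.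
Proof.
move=> n0; rewrite -sum1_card.
rewrite (partition_big (nps (cells lam)) (fun S => is_syt lam S && Q S)) /=; last first.
  by move=> T; rewrite inE => /andP[tT ->]; rewrite syt_nps.
rewrite -sum_nat_const [RHS](eq_bigl (fun S => is_syt lam S && Q S)); last first.
  by move=> S; rewrite inE.
apply: eq_bigr => S /andP[sS QS].
rewrite -(preimages_syt lam_sorted n0 sS) /preimages -sum1_card.
apply: eq_bigl => T; rewrite !inE; case: eqP => [->|_]; last by rewrite !andbF.
by rewrite QS !andbT.
Qed.

Lemma final_fsyt k x : (0 < n)%N ->
  final k x = (\prod_(c <- cells lam) hook lam c)%:R * (fsyt_at lam k x)%:R.
Proof.
move=> n0; rewrite -natrM mulnC -(sum_preimages (fun S => tof S x == k)) //.
rewrite natr_card_cond; apply: eq_bigr => T tT; rewrite tof_nps //.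
by move=> c; rewrite (mem_cells lam_sorted).
Qed.

(** * The number of tabloids and the hook length formula *)

Lemma size_cells : size (cells lam) = n.
Proof.
have -> : size (cells lam) =
    size [seq (i, j) | i <- iota 1 (size lam), j <- iota 1 (part lam i)].
  apply/perm_size/uniq_perm; first exact: uniq_cells.
    apply: allpairs_uniq_dep => [|i _|]; rewrite ?iota_uniq //.
    by move=> [a b] [a' b'] _ _ /= [-> ->].
  move=> [a b]; rewrite (mem_cells lam_sorted).
  apply/idP/allpairsPdep => [Dab|[i [j [ii jj [-> ->]]]]].
    move: (Dab) => /and3P[/= a0 b0 lb]; exists a, b; rewrite !mem_iota.
    split=> //; last by lia.
    rewrite a0 add1n ltnS leqNgt; apply/negP => la.
    by move: lb; rewrite /part nth_default; lia.
  by move: ii jj; rewrite !mem_iota -[_ \in D]/(D _) /in_diag /=; lia.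
rewrite size_allpairs_dep (eq_map (g := part lam)); last by move=> i; apply: size_iota.
congr sumn; apply: (@eq_from_nth _ 0%N); rewrite size_map size_iota // => i li.
by rewrite (nth_map 0%N) ?size_iota // nth_iota.
Qed.

(** Reading the entries in the order of [cells lam] is a bijection onto the permutations of
    [iota 1 n]. *)
Lemma card_tabloids : #|[set T : tabtype n | is_tabloid lam T]| = n`!.
Proof.
pose word (T : tabtype n) := [seq tof T c | c <- cells lam].
have inj : {in [set T : tabtype n | is_tabloid lam T] &, injective word}.
  move=> T T'; rewrite !inE => /tabloidP tT /tabloidP tT' /eq_in_map e.
  rewrite -[T]fot_tof -[T']fot_tof; congr (fot n _).
  apply: functional_extensionality => c; case Dc: (D c).
    by apply: e; rewrite (mem_cells lam_sorted).
  by rewrite (proj2 tT) ?Dc // (proj2 tT') ?Dc.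
rewrite -[in RHS](size_iota 1 n) -size_permutations ?iota_uniq //.
rewrite cardE -(size_map word); apply: perm_size; apply: uniq_perm.
- by rewrite map_inj_in_uniq ?enum_uniq // => T T'; rewrite !mem_enum; apply: inj.
- exact: permutations_uniq.
move=> t; rewrite mem_permutations; apply/mapP/idP => [[T]|pt].
  by rewrite mem_enum inE => /tabloidP tT ->; case: tT.
pose U c := if D c then nth 0%N t (index c (cells lam)) else 0%N.
have st : size t = size (cells lam).
  by rewrite (perm_size pt) size_iota size_cells.
have eU : [seq U c | c <- cells lam] = t.
  apply: (@eq_from_nth _ 0%N); first by rewrite size_map st.
  move=> i; rewrite size_map => li; rewrite (nth_map (1, 1)%N) // /U.
  have : nth (1, 1)%N (cells lam) i \in D by rewrite -(mem_cells lam_sorted) mem_nth.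
  by move=> Dc; rewrite -[D _]/(_ \in D) Dc index_uniq ?uniq_cells.
have tU : tabl lam U.
  by split; [rewrite eU|move=> c /negbTE; rewrite /U => ->].
exists (fot n U); last by rewrite /word tof_fot.
by rewrite mem_enum inE; apply/tabloidP => //; rewrite tof_fot.
Qed.

(** The fibre count with no condition on the result, combined with the number of all tabloids. *)
Lemma hook_formula : (0 < n)%N ->
  (n`! = fsyt lam * \prod_(c <- cells lam) hook lam c)%N.
Proof.
move=> n0; have := sum_preimages predT n0; rewrite /fsyt.
have -> : [set T : tabtype n | is_tabloid lam T && predT (nps (cells lam) T)] =
    [set T | is_tabloid lam T] by apply/setP => T; rewrite !inE andbT.
have -> : [set S : tabtype n | is_syt lam S && predT S] = [set S | is_syt lam S].
  by apply/setP => S; rewrite !inE andbT.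
by rewrite card_tabloids.
Qed.

Lemma fsyt_sum x : D x ->
  (fsyt lam)%:R = \sum_(1 <= l < n.+1) (fsyt_at lam l x)%:R :> rat.
Proof.
move=> Dx; have -> : fsyt lam = #|[set S : tabtype n | is_syt lam S && predT S]|.
  by apply: eq_card => S; rewrite !inE andbT.
rewrite natr_card_cond (eq_bigr (fun l => \sum_(S : tabtype n | is_syt lam S)
  (tof S x == l)%:R)); last by move=> l _; rewrite /fsyt_at natr_card_cond.
rewrite exchange_big /=; apply: eq_bigr => S /andP[/tabloidP tS _].
have lx := tabl_range lam_sorted tS Dx.
rewrite (bigD1_seq (tof S x)) ?iota_uniq ?mem_index_iota //= eqxx big1 ?addr0 //.
by move=> l; rewrite eq_sym => /negbTE->.
Qed.

End Drop.

Theorem theorem3 (n k : nat) (lam : seq nat) (x : nat * nat) :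
  is_partition_of lam n -> (1 <= k <= n)%N -> in_diag lam x ->
  ((dropf lam k x)%:R : rat)
    = (n`!)%:R / (n - k + 1)%:R
      * (1 - \sum_(1 <= l < k) (fsyt_at lam l x)%:R / (fsyt lam)%:R)
  /\
  ((dropf lam k x)%:R : rat)
    = (\prod_(y <- cells lam) hook lam y)%:R / (n - k + 1)%:R
      * \sum_(k <= l < n.+1) ((fsyt_at lam l x)%:R : rat).
Proof.
case/and3P => lam_sorted _ /eqP <- {n} lk Dx; set n := sumn lam in lk *.
have /andP[k0 kn] := lk; have n0 : (0 < n)%N := leq_trans k0 kn.
have m0 : (n - k + 1)%:R != 0 :> rat by rewrite pnatr_eq0 addn1.
set H := (\prod_(y <- cells lam) hook lam y)%N.
(* The second formula comes first: it is [dropf_final] with each [final l x] replaced by its fibre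
   count. *)
have drop_eq : (dropf lam k x)%:R =
    H%:R / (n - k + 1)%:R * \sum_(k <= l < n.+1) (fsyt_at lam l x)%:R :> rat.
  apply: (mulfI m0); rewrite dropf_final // mulrA [X in X * _]mulrC mulfVK //.
  by rewrite big_distrr; apply: eq_bigr => l _; rewrite final_fsyt.
split=> //; rewrite drop_eq hook_formula // natrM.
(* By the hook length formula, [fsyt lam] divides the nonzero number [n!]. The first formula then
   follows by splitting the sum of all [fsyt_at lam l x], which is [fsyt lam], at [k]. *)
have f0 : (fsyt lam)%:R != 0 :> rat.
  rewrite pnatr_eq0; apply/eqP => f0.
  by have := fact_gt0 n; rewrite /n hook_formula // f0 mul0n.
rewrite -/n -/H [(fsyt lam)%:R * _]mulrC -!mulrA; congr (_ * _).
rewrite mulrCA; congr (_ * _); rewrite -big_distrl /= mulrBr mulr1.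
rewrite [X in _ = _ - X]mulrC mulfVK // (fsyt_sum lam_sorted Dx).
by rewrite [X in _ = X - _](@big_cat_nat _ _ _ k) //= ?leqW // addrAC subrr add0r.
Qed.
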